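(* The $\mathbb{C}[[h]]$-modules $\mathcal{L}_i(\mathfrak{gl}_2)$, $i=0,1$, are irreducible both as modules for the quantum vertex algebra $\mathcal{V}^1(\mathfrak{gl}_2)$ and as level $1$ modules for the double Yangian $\mathrm{DY}(\mathfrak{gl}_2)$.
   Context: Double Yangian. Let $I$ be the identity and $P$ the permutation operator on $\mathbb{C}^2\otimes\mathbb{C}^2$, and $R(u)=\frac{1}{1+h/u}\left(I+\frac{h}{u}P\right)$. $\mathrm{DY}(\mathfrak{gl}_2)$ is the ($h$-adically completed) associative algebra over $\mathbb{C}[[h]]$ generated by a central element $C$ and $t_{ij}^{(r)}$, $i,j=1,2$, $r\in\mathbb{Z}$, subject to (1) $R_{12}(u-v)T_{13}^{\pm}(u)T_{23}^{\pm}(v)=T_{23}^{\pm}(v)T_{13}^{\pm}(u)R_{12}(u-v)$ and (2) $R_{12}(u-v-hC/2)T_{13}^{+}(u)T_{23}^{-}(v)=T_{23}^{-}(v)T_{13}^{+}(u)R_{12}(u-v+hC/2)$, where $T^{\pm}(u)=\sum_{i,j}e_{ij}\otimes t_{ij}^{\pm}(u)$, $t_{ij}^+(u)=\delta_{ij}-h\sum_{r\geq 0}t_{ij}^{(r)}u^{-r-1}$, $t_{ij}^-(u)=\delta_{ij}+h\sum_{r\geq 1}t_{ij}^{(-r)}u^{r-1}$. Relations are understood coefficientwise after cancelling overall powers of $h$ (so that the algebras are $h$-torsion free). Level $1$ means that $C$ acts as $1$. Set $k_1^{\pm}(u)=t_{11}^{\pm}(u)$, $k_2^{\pm}(u)=t_{22}^{\pm}(u)-t_{21}^{\pm}(u)t_{11}^{\pm}(u)^{-1}t_{12}^{\pm}(u)$,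 $X^+(u)=t_{11}^+(u-hC/4)^{-1}t_{12}^+(u-hC/4)-t_{11}^-(u+hC/4)^{-1}t_{12}^-(u+hC/4)$, $X^-(u)=t_{21}^+(u+hC/4)t_{11}^+(u+hC/4)^{-1}-t_{21}^-(u-hC/4)t_{11}^-(u-hC/4)^{-1}$, $X_{\pm\alpha}(u)=h^{-1}X^\pm(u)$. Modules $\mathcal{L}_i(\mathfrak{gl}_2)$. Let $\varepsilon_1,\varepsilon_2$ be the basis dual to $e_{11},e_{22}$, with form $(\varepsilon_j,\varepsilon_k)=\delta_{jk}$; $\alpha=\varepsilon_1-\varepsilon_2$, $Q=\mathbb{Z}\alpha$, $\lambda_0=0$, $\lambda_1=\alpha/2$. Let $\widehat{\mathfrak{s}}$ be the Lie algebra generated by central $C$ and $a_j(r)$ ($j=1,2$, $r\in\mathbb{Z}\setminus\{0\}$) with $[a_j(r),a_k(s)]=r\delta_{jk}\delta_{r+s,0}C$, and $\widehat{\mathfrak{s}}^-$ the subalgebra generated by $a_j(r)$, $r<0$. For $i=0,1$ let $\mathcal{F}_i=U(\widehat{\mathfrak{s}}^-)[[h]]\otimes\mathbb{C}[Q][[h]]e^{\lambda_i}$ ($h$-adically completed). On $f\otimes e^\mu$: $C$ acts as $1$; $a_j(r)$ acts by $a_j(r)f\otimes e^\mu$ for $r<0$ and by $[a_j(r),f]\otimes e^\mu$ for $r>0$; $\partial_{\varepsilon_j}(f\otimes e^\mu)=(\varepsilon_j,\mu)f\otimes e^\mu$ ($\partial_\beta$ linear in $\beta$); $e^{\beta}(f\otimes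 e^\mu)=f\otimes e^{\beta+\mu}$. Put $E^-(u)=\exp\big(\sum_{r>0}\big(-\frac{a_1(-r)}{r}(u-\frac34h)^r+\frac{a_2(-r)}{r}(u+\frac h4)^r\big)\big)$, $E^+(u)=\exp\big(\sum_{r>0}\frac{a_1(r)-a_2(r)}{r}(u+\frac h4)^{-r}\big)$, $\mathcal{E}^-(u)=E^-(0)^{-1}E^-(u)$. Each $\mathcal{F}_i$ is a $\mathrm{DY}(\mathfrak{gl}_2)$-module with $C$ acting as $1$ and $X_\alpha(u)=\mathcal{E}^-(u)E^+(u)e^\alpha u^{\partial_{\alpha/2}}(u+h)^{\partial_{\alpha/2}}$, $X_{-\alpha}(u)=\mathcal{E}^-(u+h/2)^{-1}E^+(u-h/2)^{-1}e^{-\alpha}(u-h/2)^{-\partial_{\alpha/2}}(u+h/2)^{-\partial_{\alpha/2}}$, $k_j^+(u)=\exp\big(-\sum_{r>0}\frac{a_j(r)}{r}((u+\frac h2)^{-r}-(u-\frac h2)^{-r})\big)\,c_j(u)^{\partial_{\alpha/2}}$ with $c_1(u)=\frac{u+h/4}{u+5h/4}$, $c_2(u)=\frac{u+h/4}{u-3h/4}$, $k_1^-(u)=\exp\big(\sum_{r>0}\frac{a_2(-r)}{r}((u+h)^r-u^r)\big)$, $k_2^-(u)=\exp\big(\sum_{r>0}\frac{a_1(-r)}{r}(u^r-(u-h)^r)\big)$. Expressions such as $(u+ah)^p$ are expanded in nonnegative powers of $h$. Then $\mathcal{L}_0(\mathfrak{gl}_2)=\mathrm{DY}(\mathfrak{gl}_2)\cdot(1\otimes1)\subset\mathcal{F}_0$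 and $\mathcal{L}_1(\mathfrak{gl}_2)=\mathrm{DY}(\mathfrak{gl}_2)\cdot(1\otimes e^{\lambda_1})\subset\mathcal{F}_1$. $T^\pm(u)_{\mathcal{L}_i}$ denotes the action of $T^\pm(u)$ on $\mathcal{L}_i=\mathcal{L}_i(\mathfrak{gl}_2)$. Quantum vertex algebra $\mathcal{V}^1(\mathfrak{gl}_2)$. The dual Yangian $\mathrm{Y}^+(\mathfrak{gl}_2)$ is the $\mathbb{C}[[h]]$-algebra generated by $t_{ij}^{(-r)}$, $i,j=1,2$, $r\geq1$, subject to (1) for $T^-$; it is a subalgebra of $\mathrm{DY}(\mathfrak{gl}_2)$. $\mathcal{V}^1(\mathfrak{gl}_2)$ is its $h$-adic completion equipped with the $\mathrm{DY}(\mathfrak{gl}_2)$-action in which $C$ acts as $1$, $t_{ij}^{(-r)}$ ($r\geq1$) act by left multiplication, and $t_{ij}^{(r)}1=0$ for $r\geq0$. By Etingof–Kazhdan it carries a unique quantum vertex algebra structure with vacuum vector $1$ and vertex operator map satisfying, for $n\geq 1$, $$Y(T^-_{1n}(u_1)\cdots T^-_{n-1\,n}(u_{n-1}),z)=T^-_{1n}(z+u_1)\cdots T^-_{n-1\,n}(z+u_{n-1})\,T^+_{n-1\,n}(z+u_{n-1}-h/2)^{-1}\cdots T^+_{1n}(z+u_1-h/2)^{-1}.$$ Here $T^{-}_{jn}(u)$ has its matrix part in the $j$-th factor of $(\mathrm{End}\,\mathbb{C}^2)^{\otimes(n-1)}$ and its algebra part in the $n$-th factor; in the argument of $Y$ the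 product is applied to the vacuum vector, both sides are compared coefficientwise in the matrix entries and $u_1,\ldots,u_{n-1}$, and $(z+u_j)^p$ is expanded in nonnegative powers of $u_j$. A module for a quantum vertex algebra $(V,Y,\boldsymbol{1})$ is a topologically free $\mathbb{C}[[h]]$-module $W$ with a $\mathbb{C}[[h]]$-linear map $v\mapsto Y_W(v,z)\in\mathrm{Hom}(W,W((z))_h)$, where $W((z))_h$ is the $h$-adic completion of $W((z))$, such that $Y_W(\boldsymbol{1},z)=\mathrm{id}_W$ and for all $u,v\in V$, $w\in W$, $k\geq0$ there is $r\geq0$ with $(z_0+z_2)^rY_W(u,z_0+z_2)Y_W(v,z_2)w-(z_0+z_2)^rY_W(Y(u,z_0)v,z_2)w\in h^kW[[z_0^{\pm1},z_2^{\pm1}]]$. The $\mathcal{V}^1(\mathfrak{gl}_2)$-module structure on $\mathcal{L}_i$ is the unique one given by $$Y_{\mathcal{L}_i}(T^-_{1n}(u_1)\cdots T^-_{n-1\,n}(u_{n-1}),z)=T^-_{1n}(z+u_1)_{\mathcal{L}_i}\cdots T^-_{n-1\,n}(z+u_{n-1})_{\mathcal{L}_i}\,T^+_{n-1\,n}(z+u_{n-1}-h/2)_{\mathcal{L}_i}^{-1}\cdots T^+_{1n}(z+u_1-h/2)_{\mathcal{L}_i}^{-1},\quad n\geq1.$$ Irreducibility. A topologically free $\mathbb{C}[[h]]$-module $V$ is irreducible with respect to the action of an associative algebra (resp. quantum vertex algebra) if it does not possess any nontrivial topologically free $\mathbb{C}[[h]]$-submodule $W$ which is invariant under that action and is such that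 $h^nv\in W$ for $n\geq1$ and $v\in V$ implies $v\in W$. *)

(* Defs.v *)
From HB Require Import structures.
From mathcomp Require Import all_boot all_order all_algebra.
From mathcomp Require Import finmap generic_quotient.
From mathcomp Require Import boolp classical_sets.
From mathcomp.multinomials Require Import monalg.
From mathcomp Require Import reals complex.
Set Implicit Arguments.
Unset Strict Implicit.
Unset Printing Implicit Defensive.
Import GRing.Theory.
Local Open Scope classical_set_scope.
Local Open Scope ring_scope.

(* [hps V] is V[[h]]: a sequence stands for \sum_n (x n) h^n. *)
Definition hps (V : Type) : Type := nat -> V.

HB.instance Definition _ (V : Type) := gen_eqMixin (hps V).
HB.instance Definition _ (V : Type) := gen_choiceMixin (hps V).

Lemma hpsP (V : Type) (x y : hps V) : (forall n, x n = y n) -> x = y.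
Proof. by move=> e; apply/funext. Qed.

Section HpsZmod.
Variable V : zmodType.
Implicit Types x y z : hps V.

Definition hps_zero : hps V := fun _ => 0.
Definition hps_opp x : hps V := fun n => - x n.
Definition hps_add x y : hps V := fun n => x n + y n.

Lemma hps_addA : associative hps_add.
Proof. by move=> x y z; apply: hpsP => n; rewrite /hps_add addrA. Qed.
Lemma hps_addC : commutative hps_add.
Proof. by move=> x y; apply: hpsP => n; rewrite /hps_add addrC. Qed.
Lemma hps_add0 : left_id hps_zero hps_add.
Proof. by move=> x; apply: hpsP => n; rewrite /hps_add add0r. Qed.
Lemma hps_addN : left_inverse hps_zero hps_opp hps_add.
Proof. by move=> x; apply: hpsP => n; rewrite /hps_add addNr. Qed.

HB.instance Definition _ :=
  GRing.isZmodule.Build (hps V) hps_addA hps_addC hps_add0 hps_addN.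

Lemma hpsDE x y n : (x + y) n = x n + y n. Proof. by []. Qed.

Lemma conv_reindex (f : nat -> nat -> nat -> V) n :
  \sum_(i < n.+1) \sum_(j < (n - i).+1) f i j (n - i - j)%N =
  \sum_(k < n.+1) \sum_(i < k.+1) f i (k - i)%N (n - k)%N.
Proof.
transitivity (\sum_(0 <= i < n.+1) \sum_(0 <= k < n.+1 | (i <= k)%N)
                 f i (k - i)%N (n - k)%N).
  rewrite big_mkord; apply: eq_bigr => -[i /= ltin] _.
  rewrite -(@big_nat_widenl _ _ _ i 0 n.+1 xpredT) //.
  have := big_addn 0 n.+1 i xpredT (fun k => f i (k - i)%N (n - k)%N).
  rewrite add0n => ->; rewrite subSn // big_mkord.
  by apply: eq_bigr => j _; rewrite addnK addnC subnDA.
rewrite (exchange_big_dep_nat xpredT) //= big_mkord.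
apply: eq_bigr => -[k /= ltk] _; rewrite -(big_mkord xpredT (fun i => f i (k - i)%N (n - k)%N)).
by rewrite (@big_nat_widen _ _ _ 0 k.+1 n.+1).
Qed.
End HpsZmod.


Section HpsRing.
Variable A : nzRingType.
Implicit Types x y z : hps A.

Definition hps_one : hps A := fun n => (n == 0%N)%:R.
Definition hps_mul x y : hps A := fun n => \sum_(i < n.+1) x i * y (n - i)%N.

Lemma hps_mulA : associative hps_mul.
Proof.
move=> x y z; apply: hpsP => n; rewrite /hps_mul.
under eq_bigr => i _ do rewrite mulr_sumr.
rewrite (conv_reindex (fun i j k => x i * (y j * z k))).
by apply: eq_bigr => k _; rewrite mulr_suml; apply: eq_bigr => i _; rewrite mulrA.
Qed.
Lemma hps_mul1l : left_id hps_one hps_mul.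
Proof.
move=> x; apply: hpsP => n; rewrite /hps_mul big_ord_recl subn0 mul1r.
by rewrite big1 ?addr0 // => i _; rewrite mul0r.
Qed.
Lemma hps_mul1r : right_id hps_one hps_mul.
Proof.
move=> x; apply: hpsP => n; rewrite /hps_mul big_ord_recr /= subnn mulr1.
rewrite big1 ?add0r // => i _; rewrite /hps_one subn_eq0 leqNgt ltn_ord.
by rewrite mulr0.
Qed.
Lemma hps_mulDl : left_distributive hps_mul +%R.
Proof.
move=> x y z; apply: hpsP => n; rewrite hpsDE /hps_mul -big_split.
by apply: eq_bigr => i _; rewrite mulrDl.
Qed.
Lemma hps_mulDr : right_distributive hps_mul +%R.
Proof.
move=> x y z; apply: hpsP => n; rewrite hpsDE /hps_mul -big_split.
by apply: eq_bigr => i _; rewrite mulrDr.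
Qed.
Lemma hps_oner_neq0 : hps_one != 0.
Proof.
by apply/eqP => /(congr1 (fun f : hps A => f 0%N)) /eqP; rewrite oner_eq0.
Qed.

HB.instance Definition _ := GRing.Zmodule_isNzRing.Build (hps A)
  hps_mulA hps_mul1l hps_mul1r hps_mulDl hps_mulDr hps_oner_neq0.

Lemma hpsME x y n : (x * y) n = \sum_(i < n.+1) x i * y (n - i)%N.
Proof. by []. Qed.
End HpsRing.

Section HpsComRing.
Variable A : comNzRingType.
Lemma hps_mulC (x y : hps A) : x * y = y * x.
Proof.
apply: hpsP => n; rewrite !hpsME (reindex_inj rev_ord_inj) /=.
by apply: eq_bigr => i _; rewrite subSS subKn -1?ltnS // mulrC.
Qed.
HB.instance Definition _ := GRing.PzRing_hasCommutativeMul.Build (hps A) hps_mulC.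
End HpsComRing.

Section HpsLmod.
Variables (K : comNzRingType) (V : lmodType K).
Implicit Types (c d : hps K) (x y : hps V).

Definition hps_scale c x : hps V := fun n => \sum_(i < n.+1) c i *: x (n - i)%N.

Lemma hps_scaleA c d x : hps_scale c (hps_scale d x) = hps_scale (c * d) x.
Proof.
apply: hpsP => n; rewrite /hps_scale.
under eq_bigr => i _ do rewrite scaler_sumr.
rewrite (conv_reindex (fun i j k => c i *: (d j *: x k))).
apply: eq_bigr => k _; rewrite hpsME scaler_suml.
by apply: eq_bigr => i _; rewrite scalerA.
Qed.
Lemma hps_scale1 : left_id 1 hps_scale.
Proof.
move=> x; apply: hpsP => n; rewrite /hps_scale big_ord_recl subn0 scale1r.
by rewrite big1 ?addr0 // => i _; rewrite scale0r.
Qed.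
Lemma hps_scaleDr : right_distributive hps_scale +%R.
Proof.
move=> c x y; apply: hpsP => n; rewrite hpsDE /hps_scale -big_split.
by apply: eq_bigr => i _; rewrite scalerDr.
Qed.
Lemma hps_scaleDl x : {morph hps_scale^~ x : c d / c + d}.
Proof.
move=> c d; apply: hpsP => n; rewrite hpsDE /hps_scale -big_split.
by apply: eq_bigr => i _; rewrite scalerDl.
Qed.

HB.instance Definition _ := GRing.Zmodule_isLmodule.Build (hps K) (hps V)
  hps_scaleA hps_scale1 hps_scaleDr hps_scaleDl.

Lemma hpsZE c x n : (c *: x) n = \sum_(i < n.+1) c i *: x (n - i)%N.
Proof. by []. Qed.
End HpsLmod.

Section HpsLalg.
Variables (K : comNzRingType) (A : lalgType K).
Implicit Types (c : hps K) (x y : hps A).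

Lemma hps_scalerAl c x y : c *: (x * y) = c *: x * y.
Proof.
apply: hpsP => n; rewrite hpsZE hpsME.
under eq_bigr => i _ do rewrite hpsME scaler_sumr.
rewrite (conv_reindex (fun i j k => c i *: (x j * y k))).
apply: eq_bigr => k _; rewrite hpsZE mulr_suml.
by apply: eq_bigr => i _; rewrite scalerAl.
Qed.
HB.instance Definition _ :=
  GRing.Lmodule_isLalgebra.Build (hps K) (hps A) hps_scalerAl.
End HpsLalg.

Definition hvar {K : comNzRingType} : hps K := fun n => (n == 1%N)%:R.
Definition hconst {V : zmodType} (a : V) : hps V :=
  fun n => if n == 0%N then a else 0.

Section HAdic.
Variables (K : fieldType) (M : lmodType (hps K)).
Implicit Types (x y : M) (W : set M).

Definition hdvd (n : nat) x := exists y, x = hvar ^+ n *: y.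

Definition is_hsum (I : choiceType) (F : I -> M) (s : M) :=
  forall n, exists J : {fset I}, forall J' : {fset I},
    (J `<=` J')%fset -> hdvd n (s - \sum_(i <- J') F i).

(* Sum of an h-adically summable family; the sum is unique as soon as M is
   h-adically separated, and the value is 0 if there is no sum. *)
Definition hsum (I : choiceType) (F : I -> M) : M := xget 0 (is_hsum F).

(* W is a submodule of M that is isomorphic to V0[[h]] for some vector space
   V0 over K. *)
Definition topfree W := exists (V0 : lmodType K) (f : {linear hps V0 -> M}),
  injective f /\ range f = W.

(* [ops] is the set of operators by which the structure under consideration
   acts on M. *)
Definition irreducible_under (ops : set (M -> M)) :=
  topfree setT /\
  forall W, topfree W ->
    (forall op, ops op -> forall w, W w -> W (op w)) ->
    (forall n v, (1 <= n)%N -> W (hvar ^+ n *: v) -> W v) ->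
    W = [set 0] \/ W = setT.

(* Elements of Hom(M, M[[z^{+1}, z^{-1}]]): [A w m] is the coefficient of z^m
   in A(z)w. *)
Definition zfield := M -> int -> M.
Implicit Types A B : zfield.

(* Values in M((z))_h, the h-adic completion of M((z)). *)
Definition hlaurent A := forall w n, exists N : int,
  forall m, m < N -> hdvd n (A w m).

Definition fzero : zfield := fun _ _ => 0.
Definition fconst (f : M -> M) : zfield := fun w m => if m == 0 then f w else 0.
Definition fone : zfield := fconst id.
Definition fadd A B : zfield := fun w m => A w m + B w m.
Definition fsub A B : zfield := fun w m => A w m - B w m.
Definition fscale (c : hps K) A : zfield := fun w m => c *: A w m.
Definition fsum (I : choiceType) (F : I -> zfield) : zfield :=
  fun w m => hsum (fun i => F i w m).
Definition fcomp A B : zfield :=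
  fun w m => hsum (fun k => A (B w k) (m - k)).
Definition fpow A (n : nat) : zfield := iter n (fcomp A) fone.

Definition fexp A : zfield :=
  fsum (fun k : nat => fscale (hconst (k`!%:R^-1)) (fpow A k)).

(* A(z)^{-1} as the geometric series \sum_k (1 - A(z))^k, for A(z) such that
   1 - A(z) is topologically nilpotent for the (h, z)-adic or (h, z^{-1})-adic
   topology. *)
Definition finv A : zfield := fsum (fun k : nat => fpow (fsub fone A) k).

Definition gbin (x : K) (k : nat) : K := (\prod_(i < k) (x - i%:R)) / k`!%:R.

(* Coefficient of u^m in (u + a h)^r, expanded in nonnegative powers of h. *)
Definition pow_shift (a : K) (r m : int) : hps K :=
  if r - m is Posz k then hconst (gbin r%:~R k * a ^+ k) * hvar ^+ k else 0.

(* Coefficient of u^m in u^N (1 + a h/u)^p (1 + b h/u)^q; for p + q = N this is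
   (u + a h)^p (u + b h)^q. *)
Definition pow_shift2 (N : int) (a p b q : K) (m : int) : hps K :=
  if N - m is Posz k then
    hconst (\sum_(i < k.+1)
      gbin p i * a ^+ i * (gbin q (k - i) * b ^+ (k - i))) * hvar ^+ k
  else 0.

(* A(z + a h), expanded in nonnegative powers of h. *)
Definition fshift (a : K) A : zfield :=
  fun w m => hsum (fun p => pow_shift a p m *: A w p).

(* Coefficient of u^q in A(z + u), expanded in nonnegative powers of u. *)
Definition fder (q : nat) A : zfield :=
  fun w m => hconst (gbin (m + q%:Z)%:~R q) *: A w (m + q%:Z).

Definition mfield := 'I_2 -> 'I_2 -> zfield.
Implicit Types S T : mfield.

Definition mone : mfield := fun i j => if i == j then fone else fzero.
Definition msub S T : mfield := fun i j => fsub (S i j) (T i j).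
Definition mcomp S T : mfield :=
  fun i j w m => \sum_(l < 2) fcomp (S i l) (T l j) w m.
Definition mpow T (n : nat) : mfield := iter n (mcomp T) mone.
Definition minv T : mfield :=
  fun i j => fsum (fun k : nat => mpow (msub mone T) k i j).
End HAdic.
Arguments hsum {K M I} F.
Arguments zfield {K} M.
Arguments fzero {K M}.
Arguments fone {K M}.
Notation "A ** B" := (fcomp A B) (at level 40, left associativity).

(* For an algebra A over K (below: a free algebra), the quotient of A[[h]] by
   the smallest h-adically closed two-sided ideal which contains Rel and is
   stable under cancellation of h. This is the h-adic completion of the
   h-torsion free C[[h]]-algebra presented by Rel. *)
Section PresentedAlgebra.
Variables (K : fieldType) (A : lalgType K) (Rel : set (hps A)).
Implicit Types (J : set (hps A)) (x y z : hps A) (c : hps K).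

Record hideal J : Prop := HIdeal {
  hideal0 : J 0;
  hidealB : forall x y, J x -> J y -> J (x - y);
  hidealZ : forall c x, J x -> J (c *: x);
  hidealMl : forall z x, J x -> J (z * x);
  hidealMr : forall z x, J x -> J (x * z);
  hideal_sat : forall x, J (hvar *: x) -> J x;
  hideal_closed : forall x,
    (forall n, exists2 y, J y & hdvd n (x - y)) -> J x }.

Definition rel_ideal x := forall J, hideal J -> Rel `<=` J -> J x.

Lemma rel_idealP : hideal rel_ideal.
Proof.
split=> [J hJ _|x y Ix Iy J hJ RJ|c x Ix J hJ RJ|z x Ix J hJ RJ|z x Ix J hJ RJ|
         x Ix J hJ RJ|x Ix J hJ RJ].
- exact: hideal0 hJ.
- by apply: (hidealB hJ); [exact: Ix|exact: Iy].
- by apply: (hidealZ hJ); exact: Ix.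
- by apply: (hidealMl hJ); exact: Ix.
- by apply: (hidealMr hJ); exact: Ix.
- by apply: (hideal_sat hJ); exact: Ix.
- by apply: (hideal_closed hJ) => n; have [y Iy xy] := Ix n; exists y => //; exact: Iy.
Qed.

Let I0 := hideal0 rel_idealP.
Let IB := hidealB rel_idealP.
Let IN x : rel_ideal x -> rel_ideal (- x).
Proof. by move=> Ix; rewrite -[- x]add0r; exact: IB. Qed.
Let ID x y : rel_ideal x -> rel_ideal y -> rel_ideal (x + y).
Proof. by move=> Ix Iy; rewrite -[y]opprK; apply: IB => //; exact: IN. Qed.

Definition rel_eq : rel (hps A) := fun x y => `[< rel_ideal (x - y) >].

Lemma rel_eq_refl : reflexive rel_eq.
Proof. by move=> x; apply/asboolP; rewrite subrr. Qed.
Lemma rel_eq_sym : symmetric rel_eq.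
Proof.
by move=> x y; apply/asboolP/asboolP => /IN; rewrite opprB.
Qed.
Lemma rel_eq_trans : transitive rel_eq.
Proof.
move=> y x z /asboolP xy /asboolP yz; apply/asboolP.
by have := ID xy yz; rewrite addrA subrK.
Qed.

Canonical rel_equiv := EquivRel rel_eq rel_eq_refl rel_eq_sym rel_eq_trans.

Definition palg : Type := {eq_quot rel_equiv}%qT.
HB.instance Definition _ := Choice.on palg.
HB.instance Definition _ := EqQuotient.on palg.

Definition pproj (x : hps A) : palg := \pi_palg%qT x.

Lemma pprojP x y : rel_ideal (x - y) -> pproj x = pproj y.
Proof. by move=> e; apply/eqquotP/asboolP. Qed.
Lemma pproj_repr x : rel_ideal (repr (pproj x) - x).
Proof. by apply/asboolP/(@eqquotP _ _ palg); exact: reprK. Qed.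
Lemma pprojW (P : palg -> Prop) : (forall x, P (pproj x)) -> forall a, P a.
Proof. by move=> h a; rewrite -(reprK a); exact: h. Qed.

Definition palg_add (a b : palg) : palg := pproj (repr a + repr b).
Definition palg_opp (a : palg) : palg := pproj (- repr a).
Definition palg_mul (a b : palg) : palg := pproj (repr a * repr b).
Definition palg_scale c (a : palg) : palg := pproj (c *: repr a).

Lemma palg_addE x y : palg_add (pproj x) (pproj y) = pproj (x + y).
Proof.
apply: pprojP; have := ID (pproj_repr x) (pproj_repr y).
by rewrite opprD addrACA.
Qed.
Lemma palg_oppE x : palg_opp (pproj x) = pproj (- x).
Proof. by apply: pprojP; have := IN (pproj_repr x); rewrite opprD. Qed.
Lemma palg_mulE x y : palg_mul (pproj x) (pproj y) = pproj (x * y).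
Proof.
apply: pprojP; set x' := repr (pproj x); set y' := repr (pproj y).
have -> : x' * y' - x * y = (x' - x) * y' + x * (y' - y).
  by rewrite mulrBl mulrBr addrA subrK.
apply: ID; first exact: (hidealMr rel_idealP _ (pproj_repr x)).
exact: (hidealMl rel_idealP _ (pproj_repr y)).
Qed.
Lemma palg_scaleE c x : palg_scale c (pproj x) = pproj (c *: x).
Proof.
by apply: pprojP; rewrite -scalerBr; exact: (hidealZ rel_idealP _ (pproj_repr x)).
Qed.

Fact palg_addA : associative palg_add.
Proof.
by elim/pprojW=> x; elim/pprojW=> y; elim/pprojW=> z; rewrite !palg_addE addrA.
Qed.
Fact palg_addC : commutative palg_add.
Proof. by elim/pprojW=> x; elim/pprojW=> y; rewrite !palg_addE addrC. Qed.
Fact palg_add0 : left_id (pproj 0) palg_add.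
Proof. by elim/pprojW=> x; rewrite palg_addE add0r. Qed.
Fact palg_addN : left_inverse (pproj 0) palg_opp palg_add.
Proof. by elim/pprojW=> x; rewrite palg_oppE palg_addE addNr. Qed.
HB.instance Definition _ :=
  GRing.isZmodule.Build palg palg_addA palg_addC palg_add0 palg_addN.

Fact palg_mulA : associative palg_mul.
Proof.
by elim/pprojW=> x; elim/pprojW=> y; elim/pprojW=> z; rewrite !palg_mulE mulrA.
Qed.
Fact palg_mul1l : left_id (pproj 1) palg_mul.
Proof. by elim/pprojW=> x; rewrite palg_mulE mul1r. Qed.
Fact palg_mul1r : right_id (pproj 1) palg_mul.
Proof. by elim/pprojW=> x; rewrite palg_mulE mulr1. Qed.
Fact palg_mulDl : left_distributive palg_mul +%R.
Proof.
elim/pprojW=> x; elim/pprojW=> y; elim/pprojW=> z.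
by rewrite [_ + _]palg_addE !palg_mulE [RHS]palg_addE mulrDl.
Qed.
Fact palg_mulDr : right_distributive palg_mul +%R.
Proof.
elim/pprojW=> x; elim/pprojW=> y; elim/pprojW=> z.
by rewrite [_ + _]palg_addE !palg_mulE [RHS]palg_addE mulrDr.
Qed.
HB.instance Definition _ := GRing.Zmodule_isPzRing.Build palg
  palg_mulA palg_mul1l palg_mul1r palg_mulDl palg_mulDr.

Fact palg_scaleA c d (a : palg) :
  palg_scale c (palg_scale d a) = palg_scale (c * d) a.
Proof. by elim/pprojW: a => x; rewrite !palg_scaleE scalerA. Qed.
Fact palg_scale1 : left_id 1 palg_scale.
Proof. by elim/pprojW=> x; rewrite palg_scaleE scale1r. Qed.
Fact palg_scaleDr : right_distributive palg_scale +%R.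
Proof.
move=> c; elim/pprojW=> x; elim/pprojW=> y.
by rewrite [_ + _]palg_addE !palg_scaleE [RHS]palg_addE scalerDr.
Qed.
Fact palg_scaleDl (a : palg) : {morph palg_scale^~ a : c d / c + d}.
Proof.
by elim/pprojW: a => x c d; rewrite !palg_scaleE [RHS]palg_addE scalerDl.
Qed.
HB.instance Definition _ := GRing.Zmodule_isLmodule.Build (hps K) palg
  palg_scaleA palg_scale1 palg_scaleDr palg_scaleDl.

Lemma pprojD x y : pproj (x + y) = pproj x + pproj y.
Proof. by rewrite -palg_addE. Qed.
Lemma pprojM x y : pproj (x * y) = pproj x * pproj y.
Proof. by rewrite -palg_mulE. Qed.
Lemma pprojZ c x : pproj (c *: x) = c *: pproj x.
Proof. by rewrite -palg_scaleE. Qed.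

Lemma palg_scalerAl c (a b : palg) : c *: (a * b) = (c *: a) * b.
Proof.
elim/pprojW: a => x; elim/pprojW: b => y.
by rewrite -pprojM -!pprojZ -pprojM scalerAl.
Qed.
End PresentedAlgebra.

Section AlgebraModules.
Variables (K : fieldType) (A : lalgType K) (Rel : set (hps A)).

Record amodule (M : lmodType (hps K)) := AModule {
  act :> palg Rel -> M -> M;
  act_linearl : forall c a b w, act (c *: a + b) w = c *: act a w + act b w;
  act_linearr : forall a c v w, act a (c *: v + w) = c *: act a v + act a w;
  act1 : forall w, act 1 w = w;
  actM : forall a b w, act (a * b) w = act a (act b w) }.

Definition irreducible_amodule (M : lmodType (hps K)) (rho : amodule M) :=
  irreducible_under [set op | exists a, op = rho a].

Section Cyclic.
Variables (M : lmodType (hps K)) (rho : amodule M) (v : M).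

Definition orbit_pred : {pred M} := fun w => `[< exists a, w = rho a v >].

Fact orbit_submod : submod_closed orbit_pred.
Proof.
split=> [|c x y /asboolP[a ->] /asboolP[b ->]]; apply/asboolP.
  exists 0; have := act_linearl rho (-1) 0 0 v.
  by rewrite scaler0 addr0 scaleN1r addNr.
by exists (c *: a + b); rewrite act_linearl.
Qed.
HB.instance Definition _ :=
  GRing.isSubmodClosed.Build (hps K) M orbit_pred orbit_submod.

Record cyclic := Cyclic { cyclic_val : M; _ : cyclic_val \in orbit_pred }.
HB.instance Definition _ := [isSub for cyclic_val].
HB.instance Definition _ := [Choice of cyclic by <:].
HB.instance Definition _ := [SubChoice_isSubLmodule of cyclic by <:].

Fact cyclic_act_subproof (a : palg Rel) (w : cyclic) :
  rho a (\val w) \in orbit_pred.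
Proof.
case: w => w /= /asboolP[b ->]; apply/asboolP.
by exists (a * b); rewrite actM.
Qed.
Definition cyclic_act (a : palg Rel) (w : cyclic) : cyclic :=
  Cyclic (cyclic_act_subproof a w).

Definition cyclic_amodule : amodule cyclic.
Proof.
by exists cyclic_act => *; apply: val_inj; rewrite /= ?raddfD ?linearZ /=
  ?act_linearl ?act_linearr ?act1 ?actM.
Defined.
End Cyclic.
End AlgebraModules.

Definition free_alg (K : fieldType) (G : choiceType) : lalgType K :=
  {malg K[{fmonom G}]}.

Definition fgen (K : fieldType) (G : choiceType) (g : G) : hps (free_alg K G) :=
  hconst << fmu g >>.

Section RTT.
Variables (K : fieldType) (A : lalgType K).
Implicit Types (i j k l : 'I_2) (c : hps A) (T : 'I_2 -> 'I_2 -> int -> hps A).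

(* Coefficient of x^{-n} in the (ij, kl) matrix entry (coefficient of
   e_{ik} (x) e_{jl}) of R(x) = (1 + h/x)^{-1} (I + (h/x) P). *)
Definition Rcoef i j k l (n : nat) : hps K :=
  (- hvar) ^+ n *+ ((i == k) && (j == l)) +
  (if n is n'.+1 then (- hvar) ^+ n' * hvar else 0) *+ ((i == l) && (j == k)).

(* Coefficient of u^a v^b in (u - v + c)^{-n}, where c is divisible by h;
   expanded in nonnegative powers of c and of v. *)
Definition diff_pow c (n : nat) (a b : int) : hps A :=
  match b, - a - b - n%:Z with
  | Posz b', Posz p =>
      hconst (gbin (- n%:R : K) p * gbin (- (n + p)%:R) b' * (-1) ^+ b') *: c ^+ p
  | _, _ => 0
  end.

(* Coefficient of u^a v^b in the (ij, kl) matrix entry of R(u - v + c). *)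
Definition Rser c i j k l (a b : int) : hps A :=
  hsum (fun n : nat => Rcoef i j k l n *: diff_pow c n a b).

(* Coefficient of u^a v^b in the (ij, kl) matrix entry of
   R_{12}(u - v + c) T_{13}(u) T'_{23}(v). *)
Definition rtt_lhs c T T' i j k l (a b : int) : hps A :=
  \sum_(m < 2) \sum_(n < 2) hsum (fun p : int * int =>
    Rser c i j m n (a - p.1) (b - p.2) * (T m k p.1 * T' n l p.2)).

(* The same for T'_{23}(v) T_{13}(u) R_{12}(u - v + c). *)
Definition rtt_rhs c T T' i j k l (a b : int) : hps A :=
  \sum_(m < 2) \sum_(n < 2) hsum (fun p : int * int =>
    T' j n p.2 * T i m p.1 * Rser c m n k l (a - p.1) (b - p.2)).

(* The elements which vanish if and only if
   R_{12}(u - v + c) T_{13}(u) T'_{23}(v) =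
   T'_{23}(v) T_{13}(u) R_{12}(u - v + c'). *)
Definition rtt_rel c c' T T' : set (hps A) :=
  [set x | exists i j k l a b,
     x = rtt_lhs c T T' i j k l a b - rtt_rhs c' T T' i j k l a b].
End RTT.

Section Yangians.
Variable K : fieldType.
Implicit Types i j : 'I_2.

(* The indices 1, 2 of the matrix entries are 0, 1 : 'I_2. [None] stands for C
   and [Some (i, j, r)] for t_ij^(r). *)
Definition dy_gen : choiceType := option ('I_2 * 'I_2 * int).

Definition genC : hps (free_alg K dy_gen) := fgen K None.
Definition gen_t i j (r : int) : hps (free_alg K dy_gen) := fgen K (Some (i, j, r)).

(* Coefficients of u^m in t_ij^+(u) and t_ij^-(u). Recall Negz r = - r.+1. *)
Definition tplus i j (m : int) : hps (free_alg K dy_gen) :=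
  match m with
  | Posz 0 => (i == j)%:R
  | Posz _ => 0
  | Negz r => - (hvar *: gen_t i j r%:Z)
  end.

Definition tminus i j (m : int) : hps (free_alg K dy_gen) :=
  match m with
  | Posz r => ((r == 0%N) && (i == j))%:R + hvar *: gen_t i j (Negz r)
  | Negz _ => 0
  end.

Definition halfhC : hps (free_alg K dy_gen) := (hconst 2^-1 * hvar) *: genC.

Definition dy_rel : set (hps (free_alg K dy_gen)) :=
  [set x | exists i j r, x = genC * gen_t i j r - gen_t i j r * genC]
  `|` rtt_rel 0 0 tplus tplus `|` rtt_rel 0 0 tminus tminus
  `|` rtt_rel (- halfhC) halfhC tplus tminus.

Definition DY := palg dy_rel.
Definition dyC : DY := pproj dy_rel genC.
Definition dyt i j (r : int) : DY := pproj dy_rel (gen_t i j r).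

(* (i, j, r) stands for t_ij^(-(r+1)). *)
Definition y_gen : choiceType := ('I_2 * 'I_2 * nat)%type.

Definition y_gen_t i j (r : nat) : hps (free_alg K y_gen) := fgen K (i, j, r).

Definition y_tminus i j (m : int) : hps (free_alg K y_gen) :=
  match m with
  | Posz r => ((r == 0%N) && (i == j))%:R + hvar *: y_gen_t i j r
  | Negz _ => 0
  end.

Definition y_rel : set (hps (free_alg K y_gen)) := rtt_rel 0 0 y_tminus y_tminus.

(* The h-adically completed dual Yangian, which underlies V^1(gl_2). *)
Definition V1 := palg y_rel.
HB.instance Definition _ := GRing.PzRing.on V1.
HB.instance Definition _ := GRing.Lmodule.on V1.
Definition V1t i j (r : nat) : V1 := pproj y_rel (y_gen_t i j r).
Definition V1tminus i j (m : int) : V1 := pproj y_rel (y_tminus i j m).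

Section Modules.
Variables (M : lmodType (hps K)) (rho : amodule dy_rel M).

Definition level_one := forall w, rho dyC w = w.

Definition Tplus : mfield M := fun i j w m => rho (pproj dy_rel (tplus i j m)) w.
Definition Tminus : mfield M := fun i j w m => rho (pproj dy_rel (tminus i j m)) w.

(* The series k_j^{+-}(u) and X^{+-}(u) on a module of level 1, so that the
   shifts by h C / 4 are shifts by h / 4. *)
Local Notation o1 := (ord0 : 'I_2).
Local Notation o2 := (ord_max : 'I_2).

Definition kseries (T : mfield M) (j : 'I_2) : zfield M :=
  if j == o1 then T o1 o1
  else fsub (T o2 o2) (T o2 o1 ** finv (T o1 o1) ** T o1 o2).

Definition Xplus : zfield M :=
  fsub (finv (fshift (- 4^-1) (Tplus o1 o1)) ** fshift (- 4^-1) (Tplus o1 o2))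
       (finv (fshift 4^-1 (Tminus o1 o1)) ** fshift 4^-1 (Tminus o1 o2)).

Definition Xminus : zfield M :=
  fsub (fshift 4^-1 (Tplus o2 o1) ** finv (fshift 4^-1 (Tplus o1 o1)))
       (fshift (- 4^-1) (Tminus o2 o1) ** finv (fshift (- 4^-1) (Tminus o1 o1))).
End Modules.

Definition vacuum_action (rho : amodule dy_rel V1) :=
  [/\ level_one rho,
      forall i j (r : nat) w, rho (dyt i j (Negz r)) w = V1t i j r * w
    & forall i j (r : nat), rho (dyt i j r%:Z) 1 = 0].

(* C[[h]]-linear maps V -> Hom(W, W((z))_h), v |-> Y(v, z). *)
Record is_vertex_map (V W : lmodType (hps K)) (Y : V -> zfield W) : Prop := {
  vertex_linearl : forall c u v w m, Y (c *: u + v) w m = c *: Y u w m + Y v w m;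
  vertex_linearr : forall v c w w' m,
    Y v (c *: w + w') m = c *: Y v w m + Y v w' m;
  vertex_laurent : forall v, hlaurent (Y v) }.

(* A word l = [:: (i_1, k_1, p_1); ...; (i_N, k_N, p_N)] records the coefficient
   of u_1^{p_1} ... u_N^{p_N} in the matrix entry (i_1 ... i_N, k_1 ... k_N).
   For S(u) = T^+(u - h/2)^{-1}, this is that coefficient in
   T_1^-(z + u_1) ... T_N^-(z + u_N) S_N(z + u_N) ... S_1(z + u_1), read from the
   outermost pair T_1^-, S_1 inwards. *)
Fixpoint vertex_rhs (W : lmodType (hps K)) (T S : mfield W)
    (l : seq ('I_2 * 'I_2 * nat)) : zfield W :=
  if l is (i, k, p) :: l' then
    fun w m => \sum_(a < 2) \sum_(q < p.+1)
      (fder q (T i a) ** vertex_rhs T S l' ** fder (p - q) (S a k)) w m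
  else fone.

Definition vertex_formula (W : lmodType (hps K)) (rho : amodule dy_rel W)
    (Y : V1 -> zfield W) :=
  forall l w m, Y (\prod_(x <- l) V1tminus x.1.1 x.1.2 x.2%:Z) w m =
    vertex_rhs (Tminus rho) (fun i j => fshift (- 2^-1) (minv (Tplus rho) i j)) l w m.

Section QVAModule.
Variables (V W : lmodType (hps K)) (Y : V -> zfield V) (vac : V).
Variable YW : V -> zfield W.

(* Coefficient of z0^a z2^b in YW(u, z0 + z2) YW(v, z2) w, expanded in
   nonnegative powers of z2. *)
Definition assoc_lhs u v w (a b : int) : W :=
  hsum (fun j : nat => hconst (gbin (a + j%:Z)%:~R j : K) *:
    YW u (YW v w (b - j%:Z)) (a + j%:Z)).

Definition assoc_rhs u v w (a b : int) : W := YW (Y u v a) w b.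

(* Coefficient of z0^a z2^b in (z0 + z2)^r G(z0, z2). *)
Definition mul_binomial (r : nat) (G : int -> int -> W) (a b : int) : W :=
  \sum_(s < r.+1) G (a - (r - s)%N%:Z) (b - s%:Z) *+ 'C(r, s).

Definition weak_associativity :=
  forall u v w (k : nat), exists r : nat, forall a b,
    hdvd k (mul_binomial r (assoc_lhs u v w) a b -
            mul_binomial r (assoc_rhs u v w) a b).

Record qva_module : Prop := {
  qva_topfree : topfree [set: W];
  qva_vertex_map : is_vertex_map YW;
  qva_vacuum : forall w m, YW vac w m = fone w m;
  qva_assoc : weak_associativity }.

Definition irreducible_qva_module :=
  irreducible_under [set op | exists v m, op = fun w => YW v w m].
End QVAModule.
End Yangians.
Arguments dy_rel K _ : clear implicits.
Arguments y_rel K _ : clear implicits.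

Section Fock.
Variable K : fieldType.

(* (m, n) stands for m (x) e^{lambda_i + n alpha}, where the exponent of
   (j, r) in m is the exponent of a_j(-(r+1)); the commutative Lie algebra
   \hat{s}^- has the polynomial algebra in these variables as its enveloping
   algebra. *)
Definition fock_key : choiceType := ({cmonom ('I_2 * nat)} * int)%type.
Definition fock0 := {malg K[fock_key]}.
Definition Fock := hps fock0.
HB.instance Definition _ := GRing.Lmodule.on Fock.
Implicit Types (w : Fock) (j : 'I_2).

(* The C[[h]]-linear extension to Fock of a map defined on the basis. *)
Definition fock_ext (f : fock_key -> fock0) (w : Fock) : Fock :=
  fun d => \sum_(k <- msupp (w d)) (w d)@_k *: f k.

(* a_j(r); on the left factor it is a multiplication for r < 0 and
   [a_j(r), -] = r d/d a_j(-r) for r > 0. The value at r = 0 is not used. *)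
Definition fock_a j (r : int) : Fock -> Fock :=
  match r with
  | Posz 0 => fun _ => 0
  | Posz (r'.+1) => fock_ext (fun k =>
      << (r'.+1 * k.1 (j, r'))%:R *g (divcm k.1 (ucm (j, r')), k.2) >>)
  | Negz r' => fock_ext (fun k => << (mulcm (ucm (j, r')) k.1, k.2) >>)
  end.

Definition fock_e (n : int) : Fock -> Fock :=
  fock_ext (fun k => << (k.1, k.2 + n) >>).

(* Action by the scalar series s n on S (x) e^{lambda_i + n alpha}. *)
Definition fock_diag (s : int -> int -> hps K) : zfield Fock :=
  fun w m => hsum (fun n : int =>
    s n m *: fock_ext (fun k => if k.2 == n then << k >> else 0) w).

(* The series c s(u) f, with s(u) a scalar series. *)
Definition fock_ser (c : K) (s : int -> hps K) (f : Fock -> Fock) : zfield Fock :=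
  fun w m => (hconst c * s m) *: f w.

Local Notation o1 := (ord0 : 'I_2).
Local Notation o2 := (ord_max : 'I_2).
Local Notation "r ^^-1" := ((r.+1)%:R^-1 : K) (at level 2, format "r ^^-1").

(* In the sums over r > 0 below, r is r'.+1 for r' : nat. *)
Definition Eminus : zfield Fock := fexp (fsum (fun r' : nat => fadd
  (fock_ser (- r'^^-1) (pow_shift (- (3 / 4)) r'.+1) (fock_a o1 (- r'.+1%:Z)))
  (fock_ser r'^^-1 (pow_shift 4^-1 r'.+1) (fock_a o2 (- r'.+1%:Z))))).

Definition Eplus : zfield Fock := fexp (fsum (fun r' : nat => fadd
  (fock_ser r'^^-1 (pow_shift 4^-1 (- r'.+1%:Z)) (fock_a o1 r'.+1))
  (fock_ser (- r'^^-1) (pow_shift 4^-1 (- r'.+1%:Z)) (fock_a o2 r'.+1)))).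

Definition calEminus : zfield Fock :=
  finv (fconst (fun w => Eminus w 0)) ** Eminus.

Section LambdaI.
Variable i : 'I_2.

(* Eigenvalue (alpha/2, lambda_i + n alpha) of the operator d_{alpha/2} on
   S (x) e^{lambda_i + n alpha}. *)
Definition ev (n : int) : K := n%:~R + i%:R / 2.

(* u^{d_{alpha/2}} (u + h)^{d_{alpha/2}}: exponents ev n, whose sum is
   2 n + i. *)
Definition Xalpha : zfield Fock :=
  calEminus ** Eplus ** fconst (fock_e 1) **
  fock_diag (fun n => pow_shift2 (n *+ 2 + i%:Z) 0 (ev n) 1 (ev n)).

Definition Xmalpha : zfield Fock :=
  finv (fshift 2^-1 calEminus) ** finv (fshift (- 2^-1) Eplus) **
  fconst (fock_e (-1)) **
  fock_diag (fun n =>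
    pow_shift2 (- (n *+ 2 + i%:Z)) (- 2^-1) (- ev n) 2^-1 (- ev n)).

Definition kplus j : zfield Fock :=
  fexp (fsum (fun r' : nat => fock_ser (- r'^^-1)
    (fun m => pow_shift 2^-1 (- r'.+1%:Z) m - pow_shift (- 2^-1) (- r'.+1%:Z) m)
    (fock_a j r'.+1))) **
  fock_diag (fun n => pow_shift2 0 4^-1 (ev n)
    (if j == o1 then 5 / 4 else - (3 / 4)) (- ev n)).

Definition kminus j : zfield Fock :=
  if j == o1 then
    fexp (fsum (fun r' : nat => fock_ser r'^^-1
      (fun m => pow_shift 1 r'.+1 m - pow_shift 0 r'.+1 m) (fock_a o2 (- r'.+1%:Z))))
  else
    fexp (fsum (fun r' : nat => fock_ser r'^^-1
      (fun m => pow_shift 0 r'.+1 m - pow_shift (-1) r'.+1 m)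
      (fock_a o1 (- r'.+1%:Z)))).

Record fock_action (rho : amodule (dy_rel K) Fock) : Prop := {
  fock_level_one : level_one rho;
  fock_Xplus : forall w m, Xplus rho w m = hvar *: Xalpha w m;
  fock_Xminus : forall w m, Xminus rho w m = hvar *: Xmalpha w m;
  fock_kplus : forall j w m, kseries (Tplus rho) j w m = kplus j w m;
  fock_kminus : forall j w m, kseries (Tminus rho) j w m = kminus j w m }.
End LambdaI.

(* 1 (x) e^{lambda_i} in F_i: the carrier [Fock] of F_i does not depend on i,
   which enters only through the DY(gl_2)-action. *)
Definition fock_vac : Fock := hconst << (onecm _, 0) >>.

Definition L (rho : amodule (dy_rel K) Fock) := cyclic rho fock_vac.
HB.instance Definition _ rho := GRing.Lmodule.on (L rho).
Definition L_amodule rho : amodule (dy_rel K) (L rho) :=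
  cyclic_amodule rho fock_vac.
End Fock.

Definition CC (R : realType) : fieldType := R[i].

(* Main.v *)
Require Import Defs.
From HB Require Import structures.
From mathcomp Require Import all_boot all_order all_algebra.
From mathcomp Require Import finmap boolp classical_sets.
From mathcomp.multinomials Require Import monalg.
From mathcomp Require Import reals complex.
From mathcomp Require Import zify ring.
Import Defs.
Set Implicit Arguments.
Unset Strict Implicit.
Unset Printing Implicit Defensive.
Import Order.TTheory GRing.Theory Num.Theory.
Local Open Scope ring_scope.

(** Why the theorem holds. Reduced modulo h, the module F_i is the polynomial
    Fock space fock0 of the affine Lie algebra of gl_2, and the generators of
    the double Yangian reduce to the currents of that Lie algebra. This can be
    read off modulo h^2: there t_11^-1 t_12 is just t_12, the correction
    t_21 t_11^-1 t_12 in k_2 disappears, and the shifts of the argument have no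
    effect. The formulas for k_j^+, k_j^- and X_alpha, X_-alpha therefore
    determine the reduction [tbar] of every t_jl^(r): up to sign, the diagonal
    ones are the modes of the two bosons ([tbar_lower], [tbar_raise]) and the
    weight ([tbar_weight]), and two suitable off-diagonal ones move the vacuum
    vector of one weight to those of the neighbouring weights ([tbar_up],
    [tbar_down]).

    The classical limit is irreducible ([invariant_full]). The products
    a_j(-r) a_j(r) and the weight are diagonal on the monomial basis and
    separate it, so a nonzero invariant subspace contains a monomial; the
    annihilation modes lower it to a vacuum vector, the off-diagonal generators
    reach all other vacuum vectors, and the creation modes give everything.

    Both the orbit of the vacuum vector and a saturated topologically free
    submodule are images of complete modules, hence are everything as soon as
    they are everything modulo h ([surj_mod_h]). Applied to the orbit, this
    shows that L_i is the whole of F_i, in particular topologically free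
    ([orbit_full]). Applied to a submodule, it reduces irreducibility to the
    presence of operators which agree with the t_jl^(r) modulo h
    ([irreducible_mod_h]). For the double Yangian there is nothing more to do.
    For the quantum vertex algebra, the operator Y(t_jl^(-1), z) reduces to the
    generating series of all t_jl^(r), because
    T^-(z) T^+(z - h/2)^-1 = 1 + h sum_r t^(r) z^(-r-1) modulo h^2
    ([vertex_rhs_mod], [YL_mod]).

    That last product is an infinite sum, which converges because T^+ applied
    to a vector is a polynomial in z^-1 modulo each power of h. For t_11^+ this
    is visible from k_1^+, and the other entries are brackets of t_11^+ with
    zero modes by the RTT relation ([rtt_zero_mode], [hlaurent_Tplus]). *)

(** * Complete modules and summable families *)

Section HDivisibility.
Variables (K : fieldType) (M : lmodType (hps K)).
Implicit Types (x y z : M) (n : nat).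

Lemma hdvd0 n : hdvd n (0 : M).
Proof. by exists 0; rewrite scaler0. Qed.

Lemma hdvd0n x : hdvd 0 x.
Proof. by exists x; rewrite expr0 scale1r. Qed.

Lemma hdvdD n x y : hdvd n x -> hdvd n y -> hdvd n (x + y).
Proof. by move=> [a ->] [b ->]; exists (a + b); rewrite scalerDr. Qed.

Lemma hdvdN n x : hdvd n x -> hdvd n (- x).
Proof. by move=> [a ->]; exists (- a); rewrite scalerN. Qed.

Lemma hdvdB n x y : hdvd n x -> hdvd n y -> hdvd n (x - y).
Proof. by move=> hx /hdvdN; exact: hdvdD. Qed.

Lemma hdvdZ n (c : hps K) x : hdvd n x -> hdvd n (c *: x).
Proof. by move=> [a ->]; exists (c *: a); rewrite !scalerA mulrC. Qed.

Lemma hdvdXZ k n x : hdvd n x -> hdvd (k + n) (hvar ^+ k *: x).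
Proof. by move=> [a ->]; exists a; rewrite scalerA exprD. Qed.

Lemma hdvdhZ n x : hdvd n x -> hdvd n.+1 (hvar *: x).
Proof. by move=> /(hdvdXZ 1); rewrite expr1. Qed.

Lemma hdvdX k x : hdvd k (hvar ^+ k *: x).
Proof. by exists x. Qed.

Lemma hdvdW m n x : (m <= n)%N -> hdvd n x -> hdvd m x.
Proof.
move=> lemn [a ->]; exists (hvar ^+ (n - m) *: a).
by rewrite scalerA -exprD subnKC.
Qed.

Lemma hdvd_sum (I : Type) (r : seq I) (P : pred I) (F : I -> M) n :
  (forall i, P i -> hdvd n (F i)) -> hdvd n (\sum_(i <- r | P i) F i).
Proof.
move=> hF; elim/big_ind: _ => //; [exact: hdvd0 | exact: hdvdD].
Qed.

Lemma hdvd_seq_sum (I : eqType) (r : seq I) (F : I -> M) n :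
  (forall i, i \in r -> hdvd n (F i)) -> hdvd n (\sum_(i <- r) F i).
Proof. by move=> hF; rewrite big_seq; exact: hdvd_sum. Qed.

Lemma hdvd_trans n x y z : hdvd n (x - y) -> hdvd n (y - z) -> hdvd n (x - z).
Proof. by move=> hx hy; have := hdvdD hx hy; rewrite addrA subrK. Qed.

Lemma hdvd_sym n x y : hdvd n (x - y) -> hdvd n (y - x).
Proof. by move=> /hdvdN; rewrite opprB. Qed.

Lemma hdvd_eqD n x x' y y' :
  hdvd n (x - x') -> hdvd n (y - y') -> hdvd n ((x + y) - (x' + y')).
Proof. by move=> hx hy; rewrite opprD addrACA; exact: hdvdD. Qed.

Lemma hdvd_eqB n x x' y y' :
  hdvd n (x - x') -> hdvd n (y - y') -> hdvd n ((x - y) - (x' - y')).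
Proof. by move=> hx /hdvdN; rewrite opprD => hy; exact: hdvd_eqD. Qed.

Lemma hdvd_subr n x y : hdvd n y -> hdvd n (x - y) -> hdvd n x.
Proof. by move=> hy hxy; rewrite -(subrK y x); exact: hdvdD. Qed.

Lemma hdvdDB n x y z : hdvd n x -> hdvd n (y - z) -> hdvd n (x + y - z).
Proof. by move=> hx hyz; rewrite -addrA; exact: hdvdD. Qed.

Lemma hdvd_dropr n x y z : hdvd n z -> hdvd n (x - (y + z)) -> hdvd n (x - y).
Proof. by move=> hz; rewrite opprD addrA; exact: hdvd_subr. Qed.

Lemma hdvd_cancel n x y z : hdvd n (x + y) -> hdvd n (x - z) -> hdvd n (y + z).
Proof.
move=> hxy hxz; have := hdvdB hxy hxz.
by rewrite opprB addrC addrA subrK addrC.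
Qed.

Definition hsummable (I : choiceType) (F : I -> M) :=
  forall n, exists J : {fset I}, forall i, i \notin J -> hdvd n (F i).

(** Topological freeness is used through these three consequences only, which
    unlike a choice of a basis are easily checked and transported. *)
Record hcomplete : Prop := HComplete {
  hc_sep : forall x, (forall n, hdvd n x) -> x = 0;
  hc_sum : forall (I : choiceType) (F : I -> M), hsummable F ->
    exists s, is_hsum F s;
  hc_inj : forall x, hvar *: x = 0 -> x = 0 }.

(** A divergent sum has the value 0. Hence the divisibility of a composite of
    series can be bounded before the composite is known to make sense. *)
Lemma hsum_hdvd (I : choiceType) (F : I -> M) n :
  (forall i, hdvd n (F i)) -> hdvd n (hsum F).
Proof.
move=> hF; rewrite /hsum; case: xgetP => [s _ hs|_]; last exact: hdvd0.
have [J /(_ J (fsubset_refl _)) hJ] := hs n.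
by apply: hdvd_subr hJ; apply: hdvd_sum.
Qed.

Hypothesis hM : hcomplete.

Lemma hdvd_eq x y : (forall n, hdvd n (x - y)) -> x = y.
Proof. by move=> /(hc_sep hM) /eqP; rewrite subr_eq0 => /eqP. Qed.

Lemma hvarXZ_inj n x y : hvar ^+ n *: x = hvar ^+ n *: y -> x = y.
Proof.
move=> e; apply/eqP; rewrite -subr_eq0; apply/eqP.
have {e} : hvar ^+ n *: (x - y) = 0 by rewrite scalerBr e subrr.
elim: n => [|n IHn]; first by rewrite expr0 scale1r.
by rewrite exprS -scalerA => /(hc_inj hM).
Qed.

Lemma hdvdhZI n x : hdvd n.+1 (hvar *: x) -> hdvd n x.
Proof.
move=> [a]; rewrite exprS -scalerA => e; exists a.
by apply: (@hvarXZ_inj 1); rewrite expr1.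
Qed.

Lemma hsum_unique (I : choiceType) (F : I -> M) s : is_hsum F s -> hsum F = s.
Proof.
move=> hs; have hF : is_hsum F (hsum F) by apply: xgetPex; exists s.
apply: hdvd_eq => n; have [J hJ] := hs n; have [J' hJ'] := hF n.
have := hJ _ (fsubsetUl J J'); have := hJ' _ (fsubsetUr J J').
by move=> h1 /hdvd_sym h2; apply: hdvd_trans h1 h2.
Qed.

Lemma hsumP (I : choiceType) (F : I -> M) : hsummable F -> is_hsum F (hsum F).
Proof. by move=> hF; apply: xgetPex; exact: hc_sum. Qed.

(** Modulo h^n, a convergent sum is the finite sum of any set of terms which
    contains all those outside h^n M. *)
Lemma hsum_fset (I : choiceType) (F : I -> M) n (J : {fset I}) :
  hsummable F -> (forall i, i \notin J -> hdvd n (F i)) ->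
  hdvd n (hsum F - \sum_(i <- J) F i).
Proof.
move=> /hsumP/(_ n)[J0 hJ0] hJ.
have := hJ0 _ (fsubsetUl J0 J); move=> /hdvd_trans; apply.
rewrite (big_fsetID _ (fun i => i \in J)) /=.
have -> : [fset x in (J0 `|` J)%fset | x \in J]%fset = J.
  by apply/fsetP => x; rewrite !inE /=; case: (x \in J); rewrite ?orbT ?andbT ?andbF.
rewrite addrAC subrr add0r; apply: hdvd_seq_sum => i.
by rewrite !inE => /andP[_ /hJ].
Qed.

Lemma finite_hsummable (I : choiceType) (F : I -> M) (J : {fset I}) :
  (forall i, i \notin J -> F i = 0) -> hsummable F.
Proof. by move=> hF n; exists J => i /hF ->; exact: hdvd0. Qed.

Lemma nat_hsummable (F : nat -> M) (g : nat -> nat) :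
  (forall k, hdvd (g k) (F k)) ->
  (forall n, exists k0, forall k, (k0 <= k)%N -> (n <= g k)%N) ->
  hsummable F.
Proof.
move=> hF hg n; have [k0 hk0] := hg n; exists [fset k in iota 0 k0]%fset => k.
rewrite !inE /= mem_iota add0n -leqNgt => /hk0 h; exact: hdvdW h (hF k).
Qed.

Lemma nat_hsummable_sub (F : nat -> M) (a : nat) :
  (forall k, hdvd (k - a) (F k)) -> hsummable F.
Proof.
move=> hF; apply: (nat_hsummable hF) => n; exists (n + a)%N => k h; lia.
Qed.

Lemma hsum1 (I : choiceType) (F : I -> M) n i0 :
  hsummable F -> (forall i, i != i0 -> hdvd n (F i)) ->
  hdvd n (hsum F - F i0).
Proof.
move=> hF h; have := @hsum_fset _ F n [fset i0]%fset hF.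
rewrite big_seq_fset1; apply => i; rewrite inE; exact: h.
Qed.

Lemma hsum_single (I : choiceType) (F : I -> M) i0 :
  (forall i, i != i0 -> F i = 0) -> hsum F = F i0.
Proof.
move=> h; apply: hdvd_eq => n; apply: hsum1 => [|i /h ->]; last exact: hdvd0.
by apply: (@finite_hsummable _ _ [fset i0]%fset) => i; rewrite inE; exact: h.
Qed.

Lemma hsum_eq0 (I : choiceType) (F : I -> M) : (forall i, F i = 0) -> hsum F = 0.
Proof.
move=> h; apply: (hc_sep hM) => n; apply: hsum_hdvd => i; rewrite h; exact: hdvd0.
Qed.

Lemma hsum_nat (F : nat -> M) m n :
  hsummable F -> (forall k, (n <= k)%N -> hdvd m (F k)) ->
  hdvd m (hsum F - \sum_(k < n) F k).
Proof.
move=> hF h; have := @hsum_fset _ F m [fset k in iota 0 n]%fset hF.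
have -> : \sum_(k <- [fset k in iota 0 n]%fset) F k = \sum_(k < n) F k.
  rewrite -(big_mkord xpredT F); apply: perm_big; apply: uniq_perm => [||k].
  - exact: fset_uniq.
  - exact: iota_uniq.
  - by rewrite !inE /= /index_iota subn0.
by apply => k; rewrite !inE /= mem_iota add0n -leqNgt; exact: h.
Qed.

Lemma hsum2 (I : choiceType) (F : I -> M) n i0 i1 : i0 != i1 ->
  hsummable F -> (forall i, i != i0 -> i != i1 -> hdvd n (F i)) ->
  hdvd n (hsum F - (F i0 + F i1)).
Proof.
move=> ne hF h; have := @hsum_fset _ F n [fset i0; i1]%fset hF.
rewrite big_fsetU1 ?inE //= big_seq_fset1; apply => i.
by rewrite !inE negb_or => /andP[]; exact: h.
Qed.

Lemma hsum2_single (I : choiceType) (F : I -> M) i0 i1 : i0 != i1 ->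
  (forall i, i != i0 -> i != i1 -> F i = 0) -> hsum F = F i0 + F i1.
Proof.
move=> ne h; apply: hdvd_eq => n; apply: hsum2 => // [|i n0 n1]; last first.
  by rewrite h //; exact: hdvd0.
apply: (@finite_hsummable _ _ [fset i0; i1]%fset) => i.
by rewrite !inE negb_or => /andP[]; exact: h.
Qed.

End HDivisibility.

Arguments hcomplete {K} M.

Section PowerSeriesModule.
Variables (K : fieldType) (V : lmodType K).
Implicit Types x : hps V.

Lemma hvarZE x n : (hvar *: x) n = if n is n'.+1 then x n' else 0.
Proof.
rewrite hpsZE; case: n => [|n]; first by rewrite big_ord1 scale0r.
rewrite 2!big_ord_recl /= scale0r add0r scale1r subSS subn0 big1 ?addr0 // => i _.
by rewrite scale0r.
Qed.

Lemma hvarXZE x k n : (hvar ^+ k *: x) n = if (n < k)%N then 0 else x (n - k)%N.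
Proof.
elim: k n => [|k IHk] n; first by rewrite expr0 scale1r ltn0 subn0.
rewrite exprS -scalerA hvarZE; case: n => // n; rewrite IHk ltnS; by case: ltnP.
Qed.

Lemma hdvdP n x : hdvd n x <-> forall d, (d < n)%N -> x d = 0.
Proof.
split=> [[y ->] d ltdn|h]; first by rewrite hvarXZE ltdn.
exists (fun d => x (n + d)%N); apply: hpsP => d; rewrite hvarXZE.
by case: ltnP => [/h|/subnKC ->].
Qed.

Lemma hps_sum (I : Type) (r : seq I) (P : pred I) (F : I -> hps V) d :
  (\sum_(i <- r | P i) F i) d = \sum_(i <- r | P i) F i d.
Proof. by elim/big_rec2: _ => // i y z _ <-; rewrite hpsDE. Qed.

Lemma hps_hcomplete : hcomplete (hps V).
Proof.
split=> [x h|I F hF|x /(congr1 (fun f : hps V => f _.+1)) h].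
- by apply: hpsP => d; have /hdvdP := h d.+1; apply.
- have /choice[J hJ] := hF.
  exists (fun d => \sum_(i <- J d.+1) F i d) => n.
  exists (\bigcup_(d <- iota 0 n) J d.+1)%fset => J' sJ'.
  apply/hdvdP => d ltdn; rewrite hpsDE.
  change (\sum_(i <- J d.+1) F i d - (\sum_(i <- J') F i) d = 0).
  rewrite hps_sum [X in _ - X](big_fsetID _ (fun i => i \in J d.+1)) /=.
  have -> : [fset x in J' | x \in J d.+1]%fset = J d.+1.
    apply/fsetP => x; rewrite !inE /=; case: (boolP (x \in J d.+1)) => xJ; rewrite ?andbF //.
    rewrite andbT; apply: (fsubsetP sJ'); apply/bigfcupP; exists d => //.
    by rewrite mem_iota add0n ltdn.
  rewrite opprD addrA subrr add0r big1_seq ?oppr0 // => i.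
  by rewrite !inE /= => /andP[_ /hJ/hdvdP/(_ d (ltnSn _))].
- by apply: hpsP => d; have := h d; rewrite hvarZE.
Qed.
End PowerSeriesModule.

Lemma hdvd_morph (K : fieldType) (M N : lmodType (hps K)) (f : M -> N) n x :
  (forall c y, f (c *: y) = c *: f y) -> hdvd n x -> hdvd n (f x).
Proof. by move=> fZ [y ->]; exists (f y). Qed.

Lemma topfree_hcomplete (K : fieldType) (M : lmodType (hps K)) :
  topfree [set: M]%classic -> hcomplete M.
Proof.
move=> [V [f [finj frange]]].
have fsurj y : exists x, f x = y.
  have : [set: M]%classic y by [].
  by rewrite -frange => -[x _ <-]; exists x.
have [g gK] := choice fsurj.
have fZ c x : f (c *: x) = c *: f x by rewrite linearZ.
have gZ c x : g (c *: x) = c *: g x by apply: finj; rewrite fZ !gK.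
have [sep sm inj] := hps_hcomplete V.
split=> [x h|I F hF|x hx].
- rewrite -(gK x) (sep (g x)) ?raddf0 // => n; exact: hdvd_morph (h n).
- have [n|s hs] := sm I (g \o F).
    by have [J hJ] := hF n; exists J => i /hJ; exact: hdvd_morph.
  exists (f s) => n; have [J hJ] := hs n; exists J => J' /hJ.
  move=> /(hdvd_morph (f := f) fZ); rewrite raddfB raddf_sum /=.
  by under eq_bigr => i _ do rewrite gK.
- by rewrite -(gK x) (inj (g x)) ?raddf0 // -gZ hx; apply: finj; rewrite gK raddf0.
Qed.

(** Successive approximation: if the image of a map from a complete module
    fills M modulo h, it fills M. *)
Lemma surj_mod_h (K : fieldType) (V : lmodType K) (M : lmodType (hps K))
  (f : hps V -> M) :
  (forall x, (forall n, hdvd n (x : M)) -> x = 0) ->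
  (forall c x y, f (c *: x + y) = c *: f x + f y) ->
  (forall y, exists x, hdvd 1 (y - f x)) -> forall y, exists x, f x = y.
Proof.
move=> sep flin fh.
have /choice[g hg] y : exists p : hps V * M, y - f p.1 = hvar *: p.2.
  by have [x [z]] := fh y; rewrite expr1 => e; exists (x, z).
move=> y; pose r n := iter n (fun z => (g z).2) y.
have f0 : f 0 = 0 by have := flin (-1) 0 0; rewrite scaler0 addr0 scaleN1r addNr.
have fD a b : f (a + b) = f a + f b by have := flin 1 a b; rewrite !scale1r.
have fZ c a : f (c *: a) = c *: f a by rewrite -[c *: a]addr0 flin f0 addr0.
pose X n : hps V := hvar ^+ n *: (g (r n)).1.
have hX : hsummable X by apply: (@nat_hsummable _ _ X id) => [k|n]; [exact: hdvdX|exists n].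
have [s hs] := hc_sum (hps_hcomplete V) hX.
have part n : y - f (\sum_(i < n) X i) = hvar ^+ n *: r n.
  elim: n => [|n IHn]; first by rewrite big_ord0 f0 subr0 expr0 scale1r.
  rewrite big_ord_recr /= fD opprD addrA IHn /X fZ -scalerBr hg scalerA.
  by rewrite -exprSr.
exists s; apply/eqP; rewrite -subr_eq0; apply/eqP; apply: sep => n.
have hsn : hdvd n (s - \sum_(i < n) X i).
  rewrite -(hsum_unique (hps_hcomplete V) hs).
  apply: (hsum_nat (hps_hcomplete V) hX) => k h; exact: hdvdW h (hdvdX _ _).
apply: (@hdvd_trans _ _ _ _ (f (\sum_(i < n) X i))); last first.
  by apply: hdvd_sym; rewrite part; exact: hdvdX.
rewrite -[- f _]scaleN1r -fZ -fD scaleN1r; exact: hdvd_morph hsn.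
Qed.

(** * Series of operators *)

Definition int_range (N : nat) : {fset int} :=
  [fset (i%:Z - N%:Z)%R | i in iota 0 (N + N).+1]%fset.

Lemma in_int_range N k : (k \in int_range N) = (`|k| <= N)%N.
Proof.
apply/imfsetP/idP => [H|h].
  by case: H => i /= + ->; rewrite ?inE /= ?mem_iota => hi; lia.
exists (absz (k + N%:Z)%R); rewrite ?inE /= ?mem_iota; lia.
Qed.

Section FieldOps.
Variables (K : fieldType) (M : lmodType (hps K)).
Hypothesis hM : hcomplete M.
Implicit Types (A B : zfield M) (w x y : M) (m j : int) (n a b q : nat).

(** All coefficients of A(z) are divisible by h^a, expressed through their
    effect on the h-adic filtration, so that no linearity is involved. *)
Definition hraise a A := forall n w m, hdvd n w -> hdvd (a + n) (A w m).

Definition supp_in (P : pred int) A := forall w m, ~~ P m -> A w m = 0.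

(** The powers that occur in series in z (for true), such as T^-, and in series
    in z^-1 (for false), such as T^+. *)
Definition cone (s : bool) : pred int := fun m => if s then 0 <= m else m <= 0.

Lemma hraiseW a b A : (a <= b)%N -> hraise b A -> hraise a A.
Proof. by move=> h hA n w m /hA-/(_ m); apply: hdvdW; rewrite leq_add2r. Qed.

Lemma hraise_at0 a A m : hraise a A -> A 0 m = 0.
Proof.
move=> hA; apply: (hc_sep hM) => n.
by apply: (@hdvdW _ _ _ (a + n)); [exact: leq_addl | apply: hA; exact: hdvd0].
Qed.

Lemma hraise_hdvd a A w m : hraise a A -> hdvd a (A w m).
Proof. by move=> hA; have := hA 0%N w m (hdvd0n _); rewrite addn0. Qed.

Lemma hraise_fconst (f : M -> M) a :
  (forall n w, hdvd n w -> hdvd (a + n) (f w)) -> hraise a (fconst f).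
Proof.
by move=> hf n w m hw; rewrite /fconst; case: eqP => _; [exact: hf|exact: hdvd0].
Qed.

Lemma hraise_fone : hraise 0 (@fone _ M).
Proof. exact: hraise_fconst. Qed.

Lemma hraise_fadd a A B : hraise a A -> hraise a B -> hraise a (fadd A B).
Proof. by move=> hA hB n w m hw; apply: hdvdD; [exact: hA|exact: hB]. Qed.

Lemma hraise_fsub a A B : hraise a A -> hraise a B -> hraise a (fsub A B).
Proof. by move=> hA hB n w m hw; apply: hdvdB; [exact: hA|exact: hB]. Qed.

Lemma hraise_fscale a c A : hraise a A -> hraise a (fscale c A).
Proof. by move=> hA n w m hw; apply: hdvdZ; exact: hA. Qed.

Lemma hraise_fsum a (I : choiceType) (F : I -> zfield M) :
  (forall i, hraise a (F i)) -> hraise a (fsum F).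
Proof. by move=> hF n w m hw; apply: hsum_hdvd => i; exact: hF. Qed.

Lemma hraise_fcomp a b A B : hraise a A -> hraise b B -> hraise (a + b) (A ** B).
Proof.
move=> hA hB n w m hw; apply: hsum_hdvd => k; rewrite -addnA.
by apply: hA; exact: hB.
Qed.

Lemma hraise_fpow a A q : hraise a A -> hraise (a * q) (fpow A q).
Proof.
move=> hA; elim: q => [|q IHq]; first by rewrite muln0; exact: hraise_fone.
by rewrite mulnS; exact: hraise_fcomp.
Qed.

Lemma hraise0_fpow A q : hraise 0 A -> hraise 0 (fpow A q).
Proof. exact: hraise_fpow. Qed.

Lemma hraise_fexp A : hraise 0 A -> hraise 0 (fexp A).
Proof.
by move=> hA; apply: hraise_fsum => q; apply: hraise_fscale; exact: hraise0_fpow.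
Qed.

Lemma hraise_finv A : hraise 0 A -> hraise 0 (finv A).
Proof.
move=> hA; apply: hraise_fsum => q; apply: hraise0_fpow.
by apply: hraise_fsub => //; exact: hraise_fone.
Qed.

Section Supports.
Variable P : pred int.
Hypotheses (P0 : P 0) (PD : forall a b : int, P a -> P b -> P (a + b)).

Lemma supp_fone : supp_in P (@fone _ M).
Proof. by move=> w m; rewrite /fone /fconst; case: eqP => // ->; rewrite P0. Qed.

Lemma supp_fconst (f : M -> M) : supp_in P (fconst f).
Proof. by move=> w m; rewrite /fconst; case: eqP => // ->; rewrite P0. Qed.

Lemma supp_fadd A B : supp_in P A -> supp_in P B -> supp_in P (fadd A B).
Proof. by move=> hA hB w m hm; rewrite /fadd hA ?hB ?addr0. Qed.

Lemma supp_fsub A B : supp_in P A -> supp_in P B -> supp_in P (fsub A B).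
Proof. by move=> hA hB w m hm; rewrite /fsub hA ?hB ?subr0. Qed.

Lemma supp_fsum (I : choiceType) (F : I -> zfield M) :
  (forall i, supp_in P (F i)) -> supp_in P (fsum F).
Proof. by move=> hF w m hm; apply: hsum_eq0 => // i; exact: hF. Qed.

Lemma supp_fcomp A B : hraise 0 A -> supp_in P A -> supp_in P B ->
  supp_in P (A ** B).
Proof.
move=> pA hA hB w m hm; apply: hsum_eq0 => // k.
case: (boolP (P k)) => Pk; last by rewrite hB // (hraise_at0 _ pA).
apply: hA; apply: contra hm => Pmk.
by rewrite -(subrK k m) addrC; exact: PD.
Qed.

Lemma supp_fpow A q : hraise 0 A -> supp_in P A -> supp_in P (fpow A q).
Proof.
move=> pA hA; elim: q => [|q IHq]; first exact: supp_fone.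
exact: supp_fcomp.
Qed.

Lemma supp_fexp A : hraise 0 A -> supp_in P A -> supp_in P (fexp A).
Proof.
move=> pA hA; apply: supp_fsum => q w m hm.
by rewrite /fscale supp_fpow // scaler0.
Qed.

Lemma supp_finv A : hraise 0 A -> supp_in P A -> supp_in P (finv A).
Proof.
move=> pA hA; apply: supp_fsum => q; apply: supp_fpow.
  by apply: hraise_fsub => //; exact: hraise_fone.
by apply: supp_fsub => //; exact: supp_fone.
Qed.
End Supports.

Lemma cone0 s : cone s 0. Proof. by case: s. Qed.
Lemma coneD s (a b : int) : cone s a -> cone s b -> cone s (a + b).
Proof. by case: s; rewrite /cone; lia. Qed.

Lemma fcomp_fconst_r A (f : M -> M) w m : hraise 0 A ->
  (A ** fconst f) w m = A (f w) m.
Proof.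
move=> pA; rewrite /fcomp (hsum_single hM (i0 := 0)) => [|k /negPf hk].
  by rewrite /fconst eqxx subr0.
by rewrite /fconst hk (hraise_at0 _ pA).
Qed.

Lemma fcomp_fone_r A w m : hraise 0 A -> (A ** fone) w m = A w m.
Proof. exact: fcomp_fconst_r. Qed.

Lemma fpow1 A w m : hraise 0 A -> fpow A 1 w m = A w m.
Proof. exact: fcomp_fone_r. Qed.

Lemma hconst1 : hconst 1 = 1 :> hps K.
Proof. by apply: hpsP => -[|n]. Qed.

Lemma foneE w m : fone w m = if m == 0 then w else 0. Proof. by []. Qed.

Lemma nat1_hsum (F : nat -> M) n : hsummable F ->
  (forall k, hdvd n (F k.+1)) -> hdvd n (hsum F - F 0%N).
Proof.
move=> hF h; have := hsum_nat (n := 1) (m := n) hM hF; rewrite big_ord1; apply.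
by case=> // k _; exact: h.
Qed.

(** The geometric series 1 + (1 - A) + (1 - A)^2 + ... starts with 1, and the
    remaining terms gain a factor h each. *)
Lemma finv_mod A n y j : hraise 1 (fsub fone A) -> hdvd n y ->
  hdvd n.+1 (finv A y j - fone y j).
Proof.
move=> hA hy; have hP q := hraise_fpow q hA.
apply: (@nat1_hsum (fun k => fpow (fsub fone A) k y j)) => [|k].
  apply: (@nat_hsummable_sub _ _ _ 0) => q; rewrite subn0.
  by have := hraise_hdvd y j (hP q); rewrite mul1n.
by apply: hdvdW (hP k.+1 _ _ j hy); rewrite mul1n; lia.
Qed.

Lemma fexp_mod A n y j : hraise 1 A -> hdvd n y ->
  hdvd n.+2 (fexp A y j - (fone y j + A y j)).
Proof.
move=> hA hy; have hP q := hraise_fpow q hA.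
pose F k := fscale (hconst (k`!%:R^-1)) (fpow A k) y j.
have hF : hsummable F.
  apply: (@nat_hsummable_sub _ _ _ 0) => q; apply: hdvdZ; rewrite subn0.
  by have := hraise_hdvd y j (hP q); rewrite mul1n.
have := hsum_nat (n := 2) (m := n.+2) hM hF.
rewrite !big_ord_recl big_ord0 /= /F /fscale fpow1; last exact: hraiseW hA.
rewrite invr1 hconst1 !scale1r addr0; apply => -[|[|k]] // _.
by apply: hdvdZ; apply: hdvdW (hP k.+2 _ _ j hy); rewrite mul1n; lia.
Qed.

(** Composition is an honest (finite) convolution when both factors are series
    in z, or both in z^-1. *)
Lemma fcomp_hsummable s A B w m : hraise 0 A ->
  supp_in (cone s) A -> supp_in (cone s) B ->
  hsummable (fun k => A (B w k) (m - k)).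
Proof.
move=> pA hA hB; apply: (@finite_hsummable _ _ _ _ (int_range `|m|)) => k.
rewrite in_int_range => hk.
have [ck|ck] := boolP (cone s k); last by rewrite hB // (hraise_at0 _ pA).
by apply: hA; move: ck hk; rewrite /cone; case: s {hB}; lia.
Qed.

(** On the values of B, which are divisible by h, A^-1 is the identity modulo
    h^2; the common cone ensures convergence to all orders in h. *)
Lemma finv_comp_mod s A B w m :
  hraise 0 A -> hraise 1 (fsub fone A) -> hraise 1 B ->
  supp_in (cone s) A -> supp_in (cone s) B ->
  hdvd 2 ((finv A ** B) w m - B w m).
Proof.
move=> pA rA hB sA sB.
have near k : hdvd 2 (finv A (B w k) (m - k) - fone (B w k) (m - k)).
  by apply: finv_mod => //; exact: hraise_hdvd.
have hs : hsummable (fun k => finv A (B w k) (m - k)).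
  apply: (@fcomp_hsummable s); [exact: hraise_finv| |by []].
  by apply: supp_finv => //; [exact: cone0|exact: coneD].
apply: hdvd_trans (hsum1 (n := 2) (i0 := m) hM hs _) _ => /= [i hi|].
  by have := near i; rewrite foneE subr_eq0 eq_sym (negPf hi) subr0.
by have := near m; rewrite subrr foneE eqxx.
Qed.

(** Here A^-1 acts first, and its error term is removed by additivity. As this
    is not available for a shifted series B, it is required of a series T which
    agrees with B modulo h^2. *)
Lemma comp_finv_mod s A B (T : zfield M) w m :
  hraise 0 A -> hraise 1 (fsub fone A) -> hraise 0 B -> hraise 1 T ->
  supp_in (cone s) A -> supp_in (cone s) B ->
  (forall x y j, T (x + y) j = T x j + T y j) ->
  (forall x j, hdvd 2 (B x j - T x j)) ->
  hdvd 2 ((B ** finv A) w m - T w m).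
Proof.
move=> pA rA pB rT sA sB TD BT.
have near k : hdvd 2 (B (finv A w k) (m - k) - T (fone w k) (m - k)).
  apply: (@hdvd_trans _ _ _ _ (T (finv A w k) (m - k))); first exact: BT.
  have := finv_mod (n := 0) k rA (hdvd0n w) => /(rT _ _ (m - k)).
  have e := subrK (fone w k) (finv A w k).
  by have := TD (finv A w k - fone w k) (fone w k) (m - k); rewrite e => ->; rewrite addrK.
have hs : hsummable (fun k => B (finv A w k) (m - k)).
  apply: (@fcomp_hsummable s) => //.
  by apply: supp_finv => //; [exact: cone0|exact: coneD].
apply: hdvd_trans (hsum1 (n := 2) (i0 := 0) hM hs _) _ => /= [i hi|].
  by have := near i; rewrite foneE (negPf hi) (hraise_at0 _ rT) subr0.
by have := near 0; rewrite subr0 foneE eqxx.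
Qed.

(** The ideal of the series in z whose coefficient of z^j lies in h^(q-j): the
    q-th power of the ideal (h, z). *)
Definition gain q A := supp_in (cone true) A /\
  forall n w m, hdvd n w -> hdvd ((q - `|m|) + n) (A w m).

Lemma gain_hraise q A : gain q A -> hraise 0 A.
Proof. by move=> [_ h] n w m /h-/(_ m); apply: hdvdW; exact: leq_addl. Qed.

Lemma gain_pow A q : gain 1 A -> gain q (fpow A q).
Proof.
move=> gA; have pA := gain_hraise gA; case: (gA) => sA hA.
have sP q' : supp_in (cone true) (fpow A q').
  by apply: supp_fpow => //; exact: (@coneD true).
split=> //; elim: q => [|q IHq] n w m hw; first exact: hraise_fone.
have [cm|cm] := boolP (cone true m); last first.
  by rewrite sP //; exact: hdvd0.
apply: hsum_hdvd => k; change (hdvd ((q.+1 - `|m|) + n) (A (fpow A q w k) (m - k))).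
have [ck|ck] := boolP (cone true k); last by rewrite sP // (hraise_at0 _ pA); exact: hdvd0.
have [ck'|ck'] := boolP (cone true (m - k)); last by rewrite sA //; exact: hdvd0.
apply: hdvdW (hA _ _ (m - k) (IHq n w k hw)).
by move: cm ck ck'; rewrite /cone; lia.
Qed.

Lemma gain_hsummable A c y j : gain 1 A ->
  hsummable (fun q => hconst (c q) *: fpow A q y j).
Proof.
move=> gA; apply: (@nat_hsummable_sub _ _ _ `|j|) => q.
apply: hdvdZ; have [_ h] := gain_pow q gA.
by have := h 0%N y j (hdvd0n _); rewrite addn0.
Qed.

Lemma finv_taylor0 A n y : gain 1 (fsub fone A) -> hdvd n y ->
  hdvd n.+1 (finv A y 0 - y).
Proof.
move=> gA hy; have hs := gain_hsummable (fun=> 1) y 0 gA.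
have := nat1_hsum (n := n.+1) (F := fun k => fpow (fsub fone A) k y 0).
apply; first by move: hs; rewrite hconst1; under eq_fun do rewrite scale1r.
by move=> k; have [_ h] := gain_pow k.+1 gA; apply: hdvdW (h n y 0 hy); rewrite addSn ltnS; lia.
Qed.

Lemma fexp_taylor0 A n y : gain 1 A -> hdvd n y -> hdvd n.+1 (fexp A y 0 - y).
Proof.
move=> gA hy; have hs := gain_hsummable (fun k => k`!%:R^-1) y 0 gA.
have := nat1_hsum (n := n.+1) hs; rewrite /= invr1 hconst1 scale1r; apply => k.
by apply: hdvdZ; have [_ h] := gain_pow k.+1 gA; apply: hdvdW (h n y 0 hy); rewrite addSn ltnS; lia.
Qed.

(** Reduces exponentials and geometric series to their first term on a vector
    killed by A. *)
Lemma fpow_kill A w q m : hraise 0 A -> (forall m, A w m = 0) -> fpow A q.+1 w m = 0.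
Proof.
move=> pA hA; elim: q m => [|q IHq] m; first by rewrite fpow1.
apply: hsum_eq0 => // k; change (A (fpow A q.+1 w k) (m - k) = 0).
by rewrite IHq (hraise_at0 _ pA).
Qed.

Lemma fexp_kill A w m : hraise 0 A -> (forall m, A w m = 0) -> fexp A w m = fone w m.
Proof.
move=> pA hA; rewrite /fexp /fsum (hsum_single hM (i0 := 0%N)) => [|[|k]] //.
  by rewrite /fscale /= invr1 hconst1 scale1r.
by rewrite /fscale fpow_kill // scaler0.
Qed.

Lemma finv_kill A w m : hraise 0 A -> (forall m, A w m = fone w m) -> finv A w m = fone w m.
Proof.
move=> pA hA; rewrite /finv /fsum (hsum_single hM (i0 := 0%N)) => [|[|k]] // _.
apply: fpow_kill => [|m']; first by apply: hraise_fsub => //; exact: hraise_fone.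
by rewrite /fsub hA subrr.
Qed.

(** ** The substitution z -> z + a h *)

Lemma gbin0 (x : K) : gbin x 0 = 1.
Proof. by rewrite /gbin big_ord0 mul1r invr1. Qed.

Lemma gbin1 (x : K) : gbin x 1 = x.
Proof. by rewrite /gbin big_ord1 subr0 invr1 mulr1. Qed.

Lemma pow_shift_lt (a : K) (p m : int) : p < m -> pow_shift a p m = 0 :> hps K.
Proof. by rewrite /pow_shift; case e: (p - m) => [k|k] // h; lia. Qed.

Lemma pow_shift_diag (a : K) (p : int) : pow_shift a p p = 1.
Proof.
by rewrite /pow_shift subrr /= !expr0 !mulr1 gbin0 hconst1.
Qed.

Lemma hdvd_pow_shift (a : K) (p m : int) x n : hdvd n x ->
  hdvd (`|p - m| + n) (pow_shift a p m *: x).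
Proof.
rewrite /pow_shift => hx; case: (p - m) => k; last by rewrite scale0r; exact: hdvd0.
by rewrite -scalerA; apply: hdvdZ; exact: hdvdXZ.
Qed.

Lemma gbin_nat_gt (p k : nat) : (p < k)%N -> gbin (p%:R : K) k = 0.
Proof.
by move=> h; rewrite /gbin (bigD1 (Ordinal h)) //= subrr !mul0r.
Qed.

Lemma pow_shift_nonneg (a : K) (p m : int) : 0 <= p -> m < 0 -> pow_shift a p m = 0.
Proof.
case: p => // p _ hm; rewrite /pow_shift.
case e: (p%:Z - m) => [k|k] //; rewrite (_ : p%:~R = p%:R :> K) // gbin_nat_gt; last by lia.
rewrite mul0r; apply/hpsP => -[|n]; rewrite hpsME big1 // => i _.
  by rewrite /hconst; case: ifP; rewrite mul0r.
by rewrite /hconst; case: ifP; rewrite mul0r.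
Qed.

Lemma pow_shift0 (a : K) m : pow_shift a 0 m = (m == 0)%:R.
Proof.
have [-> |] := eqVneq m 0; first by rewrite pow_shift_diag.
have [lt|le] := ltP 0 m => m0; first by rewrite pow_shift_lt.
by rewrite pow_shift_nonneg //; lia.
Qed.

Lemma fshift_hsummable (a : K) A w m : hsummable (fun p => pow_shift a p m *: A w p).
Proof.
move=> n; exists (int_range (n + `|m|)) => p; rewrite in_int_range => hp.
have [lt|le] := ltP p m; first by rewrite pow_shift_lt // scale0r; exact: hdvd0.
by apply: hdvdW (hdvd_pow_shift _ _ _ (hdvd0n _)); lia.
Qed.

Lemma hraise_fshift (a : K) b A : hraise b A -> hraise b (fshift a A).
Proof. by move=> hA n w m hw; apply: hsum_hdvd => p; apply: hdvdZ; exact: hA. Qed.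

Lemma supp_fshift (a : K) s A : supp_in (cone s) A -> supp_in (cone s) (fshift a A).
Proof.
move=> hA w m hm; apply: hsum_eq0 => // p.
have [cp|cp] := boolP (cone s p); last by rewrite hA // scaler0.
move: s cp hm {hA}; rewrite /cone => -[] cp hm.
  by rewrite pow_shift_nonneg ?scale0r //; lia.
by rewrite pow_shift_lt ?scale0r //; lia.
Qed.

Lemma fshift_mod1 (a : K) A n y m : hraise 0 A -> hdvd n y ->
  hdvd n.+1 (fshift a A y m - A y m).
Proof.
move=> pA hy; have := hsum1 (n := n.+1) (i0 := m) hM (@fshift_hsummable a A y m).
rewrite /= pow_shift_diag scale1r; apply => p hp.
by apply: hdvdW (hdvd_pow_shift _ _ _ (pA n y p hy)); lia.
Qed.

Lemma fshift_unipotent (a : K) A : hraise 0 A -> hraise 1 (fsub fone A) ->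
  hraise 1 (fsub fone (fshift a A)).
Proof.
move=> pA rA n y m hy; rewrite /fsub.
apply: (@hdvd_trans _ _ _ _ (A y m)); first exact: rA.
by apply: hdvd_sym; rewrite add1n; exact: fshift_mod1.
Qed.

(** The first-order term a h A'(z) of the shift is divisible by h^2: the constant
    term of A(z), which need not be divisible by h, has derivative 0. *)
Lemma fshift_mod2 (a : K) A y m : (forall p, p != 0 -> hdvd 1 (A y p)) ->
  hdvd 2 (fshift a A y m - A y m).
Proof.
move=> hA; have := hsum1 (n := 2) (i0 := m) hM (@fshift_hsummable a A y m).
rewrite /= pow_shift_diag scale1r; apply => p hp.
have [lt|le] := ltP p m; first by rewrite pow_shift_lt // scale0r; exact: hdvd0.
have [p0|p0] := eqVneq p 0.
  rewrite p0 pow_shift0; case: eqP => e; last by rewrite scale0r; exact: hdvd0.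
  by rewrite p0 e eqxx in hp.
by apply: hdvdW (hdvd_pow_shift _ _ _ (hA p p0)); lia.
Qed.

Lemma fshift_fone (a : K) A w m : (forall m, A w m = fone w m) -> fshift a A w m = fone w m.
Proof.
move=> hA; rewrite /fshift (hsum_single hM (i0 := 0)) => [|p /negPf hp].
  by rewrite hA foneE eqxx pow_shift0 foneE; case: eqP; rewrite ?scale1r ?scale0r.
by rewrite hA foneE hp scaler0.
Qed.

(** * Truncation: operators with values in M((z^-1))_h and M((z))_h *)

Lemma hlaurent_fone : hlaurent (@fone _ M).
Proof.
move=> w n; exists 0 => m hm; rewrite foneE; case: eqP hm => [->|_ _]; first by rewrite ltxx.
exact: hdvd0.
Qed.

(** Modulo h^n only finitely many coefficients of B w survive, and each of them
    is killed by all but finitely many negative coefficients of A. *)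
Lemma hlaurent_fcomp A B : hraise 0 A -> hlaurent A -> hlaurent B ->
  supp_in (cone false) B -> hlaurent (A ** B).
Proof.
move=> pA lA lB sB w n; have [N hN] := lB w n.
have /choice[g hg] k := lA (B w k) n.
pose L := [seq g (- i%:Z) | i <- iota 0 `|N|.+1].
have [b hb] : exists b : int, forall x : int, x \in L -> b <= x.
  elim: L => [|x L [b hb]]; first by exists 0.
  exists (Order.min x b) => y; rewrite inE => /orP[/eqP ->|/hb]; first by lia.
  by lia.
exists (b - `|N|%:Z) => m hm; apply: hsum_hdvd => k.
have [k0|k0] := ltP 0 k.
  by rewrite sB ?(hraise_at0 _ pA); [exact: hdvd0|rewrite /cone; lia].
have [kN|kN] := ltP k N; first by apply: pA; exact: hN.
apply: hg; have : b <= g k.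
  apply: hb; apply/mapP; exists `|k|%N; first by rewrite mem_iota; lia.
  by congr g; lia.
by lia.
Qed.

Lemma hlaurent_fpow A q : hraise 0 A -> hlaurent A -> supp_in (cone false) A ->
  hlaurent (fpow A q).
Proof.
move=> pA lA sA; elim: q => [|q IHq]; first exact: hlaurent_fone.
by apply: hlaurent_fcomp => //; apply: supp_fpow => //; exact: (@coneD false).
Qed.

Lemma hlaurent_fsum (F : nat -> zfield M) :
  (forall q, hlaurent (F q)) -> (forall q, hraise q (F q)) -> hlaurent (fsum F).
Proof.
move=> lF rF w n; have /choice[g hg] q := lF q w n.
have [b hb] : exists b : int, forall q, (q < n)%N -> b <= g q.
  elim: n {hg} => [|n [b hb]]; first by exists 0.
  exists (Order.min (g n) b) => q; rewrite ltnS leq_eqVlt => /orP[/eqP ->|/hb]; first by lia.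
  by lia.
exists b => m hm; apply: hsum_hdvd => q.
have [qn|qn] := ltnP q n; first by apply: hg; have := hb q qn; lia.
exact: hdvdW qn (hraise_hdvd _ _ (rF q)).
Qed.

Lemma hlaurent_fexp A : hraise 1 A -> hlaurent A -> supp_in (cone false) A ->
  hlaurent (fexp A).
Proof.
move=> rA lA sA; have pA : hraise 0 A by exact: hraiseW rA.
apply: hlaurent_fsum => q.
  by move=> w n; have [N hN] := hlaurent_fpow q pA lA sA w n; exists N => m /hN; exact: hdvdZ.
by apply: hraise_fscale; have := hraise_fpow q rA; rewrite mul1n.
Qed.

Lemma hlaurent_fshift (a : K) A : hlaurent A -> hlaurent (fshift a A).
Proof.
move=> lA w n; have [N hN] := lA w n; exists (N - n%:Z) => m hm.
apply: hsum_hdvd => p; have [pN|pN] := ltP p N; first by apply: hdvdZ; exact: hN.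
by apply: hdvdW (hdvd_pow_shift _ _ _ (hdvd0n _)); lia.
Qed.

(** Convergence of the product of a series in z with a series in z^-1, which is
    not a finite convolution. *)
Lemma fcomp_hsummable_laurent A B w m : hraise 0 A -> hlaurent B ->
  supp_in (cone false) B -> hsummable (fun k => A (B w k) (m - k)).
Proof.
move=> pA lB sB n; have [N hN] := lB w n; exists (int_range `|N|) => k.
rewrite in_int_range => hk; have [k0|k0] := ltP 0 k.
  by rewrite sB ?(hraise_at0 _ pA); [exact: hdvd0|rewrite /cone; lia].
by apply: pA; apply: hN; lia.
Qed.

End FieldOps.

(** * The coefficient of u^-1 in the RTT relation *)

Section RTTCoefficient.
Variables (K : fieldType) (A : lalgType K).
Variable T : 'I_2 -> 'I_2 -> int -> hps A.
Hypotheses (T0 : forall i j, T i j 0 = (i == j)%:R)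
  (Tpos : forall i j m, 0 < m -> T i j m = 0).

Let hA := hps_hcomplete A.

(** For the shift 0, the expansion in powers of the shift stops at once. *)
Lemma diff_pow0 n a b : - a - b != n%:Z -> diff_pow (0 : hps A) n a b = 0.
Proof.
rewrite /diff_pow; case: b => // b ne; case e: (- a - b%:Z - n%:Z) => [[|p]|p] //.
  by move: ne e; lia.
by rewrite exprS mul0r scaler0.
Qed.

(** In powers u^a with a >= -1 no power of v occurs, since
    (u - v)^-1 = u^-1 + v u^-2 + ... *)
Lemma Rser0 i j k l a b : -1 <= a ->
  Rser (0 : hps A) i j k l a b =
    if (a == 0) && (b == 0) then Rcoef K i j k l 0 *: 1
    else if (a == -1) && (b == 0) then Rcoef K i j k l 1 *: 1 else 0.
Proof.
move=> ha; rewrite /Rser.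
have [b0|b0] := ltP b 0.
  rewrite hsum_eq0 // => [|n]; first by (do !case: eqP => //) => ? ?; lia.
  by case: b b0 => // b _; rewrite /diff_pow scaler0.
have [ab|ab] := ltP (- a - b) 0.
  rewrite hsum_eq0 // => [|n]; first by (do !case: eqP => //) => ? ?; lia.
  by rewrite diff_pow0 ?scaler0 //; lia.
rewrite (hsum_single hA (i0 := absz (- a - b)%R)) => [|n ne]; last first.
  by rewrite diff_pow0 ?scaler0 //; lia.
have [|[|]] : (a = 0 /\ b = 0) \/ (a = -1 /\ b = 0) \/ (a = -1 /\ b = 1) by lia.
- by move=> [-> ->]; rewrite /= /diff_pow /= !gbin0 !mulr1 expr0 hconst1 scale1r.
- by move=> [-> ->]; rewrite /= /diff_pow /= !gbin0 !mulr1 expr0 hconst1 scale1r.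
- move=> [-> ->]; rewrite /= /diff_pow /= gbin1 oppr0 mulr0 mul0r.
  by rewrite (_ : hconst 0 = 0) ?scale0r ?scaler0 //; apply: hpsP => -[].
Qed.

(** Scalars need not be central in the algebra, but h is. *)
Lemma mul_hvar_r (x : hps A) : x * (hvar *: 1) = hvar *: x.
Proof.
apply: hpsP => n; rewrite hvarZE hpsME; case: n => [|n].
  by rewrite big_ord1 hvarZE mulr0.
rewrite (bigD1 (Ordinal (ltnW (ltnSn n.+1)))) //= hvarZE subSn // subnn mulr1.
rewrite big1 ?addr0 // => i hi; rewrite hvarZE.
have : (i : nat) != n by [].
case e: (n.+1 - i)%N => [|[|d]] ne; rewrite ?mulr0 //; move: e ne (ltn_ord i); lia.
Qed.

(** Since R(u-v) = 1 + (P - 1) h u^-1 + O(u^-2), the coefficient of u^-1 of the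
    RTT relation involves v through a single series, and expresses that the
    zero modes act on T(v) as gl_2. *)
Lemma rtt_zero_mode i j k l b :
  rtt_lhs 0 T T i j k l (-1) b - rtt_rhs 0 T T i j k l (-1) b =
  (T i k (-1) * T j l b - T j l b * T i k (-1)) +
  hvar *: ((if j == k then T i l b else 0) - (if i == l then T j k b else 0)).
Proof.
(* As T has no positive powers, only the terms u^0 and u^-1 of R and T(u) meet. *)
have sum2 (F : int * int -> hps A) :
    (forall p, p != (-1, b) -> p != (0, b) -> F p = 0) ->
    hsum F = F (-1, b) + F (0, b).
  by move=> hF; apply: (hsum2_single hA).
have lhsE m n : hsum (fun p : int * int =>
    Rser 0 i j m n (-1 - p.1) (b - p.2) * (T m k p.1 * T n l p.2)) =
    Rcoef K i j m n 0 *: (T m k (-1) * T n l b) +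
    (if m == k then Rcoef K i j m n 1 *: T n l b else 0).
  rewrite sum2 /= => [|[p q] /=]; last first.
    have [lt|le] := ltP 0 p; first by rewrite (Tpos _ _ lt) mul0r mulr0.
    rewrite !xpair_eqE => h1 h2; rewrite Rser0; last by lia.
    by rewrite !ifF ?mul0r //; apply/negP; lia.
  rewrite !Rser0 //= !subrr /= T0 -!scalerAl !mul1r; congr (_ + _).
  by case: eqP; rewrite ?mul1r ?mul0r ?scaler0.
have rhsE m n : hsum (fun p : int * int =>
    T j n p.2 * T i m p.1 * Rser 0 m n k l (-1 - p.1) (b - p.2)) =
    (T j n b * T i m (-1)) * (Rcoef K m n k l 0 *: 1) +
    (if i == m then T j n b * (Rcoef K m n k l 1 *: 1) else 0).
  rewrite sum2 /= => [|[p q] /=]; last first.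
    have [lt|le] := ltP 0 p; first by rewrite (Tpos _ _ lt) mulr0 mul0r.
    rewrite !xpair_eqE => h1 h2; rewrite Rser0; last by lia.
    by rewrite !ifF ?mulr0 //; apply/negP; lia.
  rewrite !Rser0 //= !subrr /= T0; congr (_ + _).
  by case: eqP; rewrite ?mulr1 ?mulr0 ?mul0r.
rewrite /rtt_lhs /rtt_rhs.
under eq_bigr => m _ do under eq_bigr => n _ do rewrite lhsE.
under [X in _ - X]eq_bigr => m _ do under eq_bigr => n _ do rewrite rhsE.
have R0 i' j' k' l' : Rcoef K i' j' k' l' 0 = ((i' == k') && (j' == l'))%:R.
  by rewrite /Rcoef expr0 mul0rn addr0.
have R1 i' j' k' l' : Rcoef K i' j' k' l' 1 =
   - (hvar *+ ((i' == k') && (j' == l'))) + hvar *+ ((i' == l') && (j' == k')).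
  by rewrite /Rcoef expr1 expr0 mul1r mulNrn.
have R0r x i' j' k' l' : x * (Rcoef K i' j' k' l' 0 *: 1) = Rcoef K i' j' k' l' 0 *: x :> hps A.
  by rewrite R0; case: (_ && _); rewrite ?scale1r ?mulr1 // !scale0r mulr0.
have R1r x i' j' k' l' : x * (Rcoef K i' j' k' l' 1 *: 1) = Rcoef K i' j' k' l' 1 *: x :> hps A.
  rewrite R1 !scalerDl !scaleNr mulrDr mulrN.
  by congr (- _ + _); case: (_ && _); rewrite ?mulr1n ?mul_hvar_r // !mulr0n !scale0r mulr0.
have delta (F : 'I_2 -> 'I_2 -> hps A) p q :
    \sum_(m < 2) \sum_(n < 2) ((p == m) && (q == n))%:R *: F m n = F p q.
  rewrite (bigD1 p) //= (bigD1 q) //= !eqxx scale1r !big1 ?addr0 // => m hm.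
    by rewrite big1 // => n _; rewrite eq_sym (negPf hm) scale0r.
  by rewrite eq_sym (negPf hm) scale0r.
have delta1 (F : 'I_2 -> hps A) (c : bool) q :
    \sum_(n < 2) (hvar *+ (c && (q == n))) *: F n = if c then hvar *: F q else 0.
  case: c; last by rewrite big1 // => n _; rewrite scale0r.
  rewrite (bigD1 q) //= eqxx big1 ?addr0 // => n hn.
  by rewrite eq_sym (negPf hn) scale0r.
under eq_bigr => m _ do rewrite big_split.
under [X in _ - X]eq_bigr => m _ do rewrite big_split.
rewrite !big_split /=.
have -> : \sum_(m < 2) \sum_(n < 2) Rcoef K i j m n 0 *: (T m k (-1) * T n l b) =
    T i k (-1) * T j l b.
  by rewrite -(delta (fun m n => T m k (-1) * T n l b)); do 2!apply: eq_bigr => ? _; rewrite R0.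
have -> : \sum_(m < 2) \sum_(n < 2) T j n b * T i m (-1) * (Rcoef K m n k l 0 *: 1) =
    T j l b * T i k (-1).
  rewrite -(delta (fun m n => T j n b * T i m (-1))); do 2!apply: eq_bigr => ? _.
  by rewrite R0r R0 eq_sym (eq_sym _ l).
have -> : \sum_(m < 2) \sum_(n < 2) (if m == k then Rcoef K i j m n 1 *: T n l b else 0) =
    (if j == k then hvar *: T i l b else 0) - (if i == k then hvar *: T j l b else 0).
  rewrite (bigD1 k) //= [X in _ + X]big1 ?addr0 => [|m /negPf hm]; last first.
    by rewrite big1 // => n _; rewrite hm.
  rewrite -(delta1 (fun n => T n l b)) -(delta1 (fun n => T n l b)) -sumrB.
  apply: eq_bigr => n _; rewrite eqxx R1 scalerDl scaleNr addrC.
  by rewrite [(i == n) && _]andbC.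
have -> : \sum_(m < 2) \sum_(n < 2)
    (if i == m then T j n b * (Rcoef K m n k l 1 *: 1) else 0) =
    (if i == l then hvar *: T j k b else 0) - (if i == k then hvar *: T j l b else 0).
  rewrite (bigD1 i) //= [X in _ + X]big1 ?addr0 => [|m /negPf hm]; last first.
    by rewrite big1 // => n _; rewrite eq_sym hm.
  rewrite -(delta1 (fun n => T j n b)) -(delta1 (fun n => T j n b)) -sumrB.
  apply: eq_bigr => n _; rewrite eqxx R1r R1 scalerDl scaleNr addrC.
  by rewrite [n == l]eq_sym [n == k]eq_sym.
have hif (c : bool) x : hvar *: (if c then x else 0) = (if c then hvar *: x else 0) :> hps A.
  by case: c; rewrite ?scaler0.
rewrite scalerBr !hif opprD addrACA; congr (_ + _).
by rewrite opprB addrA subrK.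
Qed.
End RTTCoefficient.

(** * Modules over the double Yangian modulo h^2 *)

Section DYModule.
Variables (K : fieldType) (M : lmodType (hps K)).
Hypothesis hM : hcomplete M.
Variable rho : amodule (dy_rel K) M.
Implicit Types (w x y : M) (m : int) (n q : nat) (i j : 'I_2).

Lemma pprojN (x : hps (free_alg K (dy_gen))) :
  pproj (dy_rel K) (- x) = - pproj (dy_rel K) x.
Proof. by have := pprojZ (dy_rel K) (-1) x; rewrite !scaleN1r. Qed.

Lemma act_D (a b : DY K) w : rho (a + b) w = rho a w + rho b w.
Proof. by have := act_linearl rho 1 a b w; rewrite !scale1r. Qed.

Lemma act_0 w : rho 0 w = 0.
Proof. by have := act_linearl rho (-1) 0 0 w; rewrite scaler0 addr0 scaleN1r addNr. Qed.

Lemma act_Z c (a : DY K) w : rho (c *: a) w = c *: rho a w.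
Proof. by have := act_linearl rho c a 0 w; rewrite !addr0 act_0 addr0. Qed.

Lemma act_N (a : DY K) w : rho (- a) w = - rho a w.
Proof. by have := act_Z (-1) a w; rewrite !scaleN1r. Qed.

Let FA := hps (free_alg K (dy_gen)).

Lemma pactD (x y : FA) v :
  rho (pproj (dy_rel K) (x + y)) v = rho (pproj (dy_rel K) x) v + rho (pproj (dy_rel K) y) v.
Proof. by rewrite -act_D -pprojD. Qed.

Lemma pactN (x : FA) v : rho (pproj (dy_rel K) (- x)) v = - rho (pproj (dy_rel K) x) v.
Proof. by rewrite -act_N -pprojN. Qed.

Lemma pactZ c (x : FA) v :
  rho (pproj (dy_rel K) (c *: x)) v = c *: rho (pproj (dy_rel K) x) v.
Proof. by rewrite -act_Z -pprojZ. Qed.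

Lemma pactM (x y : FA) v :
  rho (pproj (dy_rel K) (x * y)) v = rho (pproj (dy_rel K) x) (rho (pproj (dy_rel K) y) v).
Proof. by rewrite -actM -pprojM. Qed.

Lemma actr_D (a : DY K) x y : rho a (x + y) = rho a x + rho a y.
Proof. by have := act_linearr rho a 1 x y; rewrite !scale1r. Qed.

Lemma actr_0 (a : DY K) : rho a 0 = 0.
Proof. by have := act_linearr rho a (-1) 0 0; rewrite scaler0 addr0 scaleN1r addNr. Qed.

Lemma actr_Z c (a : DY K) x : rho a (c *: x) = c *: rho a x.
Proof. by have := act_linearr rho a c x 0; rewrite !addr0 actr_0 addr0. Qed.

Lemma actr_N (a : DY K) x : rho a (- x) = - rho a x.
Proof. by have := actr_Z (-1) a x; rewrite !scaleN1r. Qed.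

Lemma actr_hdvd n (a : DY K) x : hdvd n x -> hdvd n (rho a x).
Proof. by move=> [y ->]; rewrite actr_Z; exists (rho a y). Qed.

(** The part of sum_r t_ij^(r) u^(-r-1) in powers u^m with m in s. *)
Definition tpart (s : pred int) i j : zfield M :=
  fun w m => if s m then rho (dyt K i j (- m - 1)) w else 0.

Definition neg : pred int := fun m => m < 0.
Definition nonneg : pred int := fun m => 0 <= m.

Lemma TplusE i j w m :
  Tplus rho i j w m = @mone K M i j w m - hvar *: tpart neg i j w m.
Proof.
rewrite /Tplus /tplus /tpart /neg /mone; case: m => [[|m]|m] /=.
- rewrite scaler0 subr0; case: eqP => _; first exact: act1.
  exact: act_0.
- rewrite scaler0 subr0 act_0; by case: eqP.
- rewrite (_ : - Negz m - 1 = m); last by lia.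
  rewrite pprojN pprojZ act_N act_Z.
  by case: eqP => _; rewrite sub0r.
Qed.

Lemma TminusE i j w m :
  Tminus rho i j w m = @mone K M i j w m + hvar *: tpart nonneg i j w m.
Proof.
rewrite /Tminus /tminus /tpart /nonneg /mone; case: m => [m|m] /=; last first.
  rewrite scaler0 addr0 act_0; by case: eqP.
rewrite pprojD act_D pprojZ act_Z (_ : - m%:Z - 1 = Negz m); last by lia.
congr (_ + _); case: (i == j); rewrite ?andbF ?andbT; last exact: act_0.
rewrite /fone /fconst eqz_nat; case: eqP => _; first exact: act1.
exact: act_0.
Qed.

Lemma tpart_linear s i j c x y m :
  tpart s i j (c *: x + y) m = c *: tpart s i j x m + tpart s i j y m.
Proof.
rewrite /tpart; case: ifP; last by rewrite scaler0 addr0.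
by rewrite actr_D actr_Z.
Qed.

Lemma tpart_D s i j x y m :
  tpart s i j (x + y) m = tpart s i j x m + tpart s i j y m.
Proof. by have := tpart_linear s i j 1 x y m; rewrite !scale1r. Qed.

Lemma hraise_tpart s i j : hraise 0 (tpart s i j).
Proof.
move=> n w m hw; rewrite /tpart; case: ifP => _; last exact: hdvd0.
exact: actr_hdvd.
Qed.

Lemma hraise_h A : hraise 0 A -> hraise 1 (fscale hvar A : zfield M).
Proof. by move=> hA n w m hw; apply: hdvdhZ; exact: hA. Qed.

Lemma hraise_mone i j : hraise 0 (@mone K M i j).
Proof.
rewrite /mone; case: eqP => _; first exact: hraise_fone.
by move=> n w m _; exact: hdvd0.
Qed.

Lemma supp_mone (P : pred int) i j : P 0 -> supp_in P (@mone K M i j).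
Proof. by move=> P0; rewrite /mone; case: eqP => _ //; exact: supp_fone. Qed.

Lemma mone_D i j x y m : @mone K M i j (x + y) m = @mone K M i j x m + @mone K M i j y m.
Proof.
rewrite /mone; case: eqP => _; last by rewrite /fzero addr0.
by rewrite /fone /fconst; case: eqP; rewrite ?addr0.
Qed.

Lemma hraise_Tplus i j : hraise 0 (Tplus rho i j).
Proof.
move=> n w m hw; rewrite TplusE; apply: hdvdB; first exact: hraise_mone.
by apply: hdvdZ; exact: hraise_tpart.
Qed.

Lemma hraise_Tminus i j : hraise 0 (Tminus rho i j).
Proof.
move=> n w m hw; rewrite TminusE; apply: hdvdD; first exact: hraise_mone.
by apply: hdvdZ; exact: hraise_tpart.
Qed.

Lemma Tplus_unipotent i j : hraise 1 (fsub (@mone K M i j) (Tplus rho i j)).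
Proof.
move=> n w m hw; rewrite /fsub TplusE opprB addrC subrK.
exact: (hraise_h (@hraise_tpart _ _ _)).
Qed.

Lemma Tminus_unipotent i j : hraise 1 (fsub (@mone K M i j) (Tminus rho i j)).
Proof.
move=> n w m hw; rewrite /fsub TminusE opprD addNKr.
by apply: hdvdN; exact: (hraise_h (@hraise_tpart _ _ _)).
Qed.

Lemma supp_Tplus i j : supp_in (cone false) (Tplus rho i j).
Proof.
move=> w m hm; rewrite TplusE (supp_mone _ _ (cone0 false)) // /tpart /neg sub0r.
by rewrite ifN ?scaler0 ?oppr0 //; move: hm; rewrite /cone; lia.
Qed.

Lemma supp_Tminus i j : supp_in (cone true) (Tminus rho i j).
Proof.
move=> w m hm; rewrite TminusE (supp_mone _ _ (cone0 true)) // /tpart /nonneg add0r.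
by rewrite ifN ?scaler0.
Qed.

(** [seriesT s] is T^- for s = true and T^+ for s = false: the index s is also
    that of the cone of powers in which the series is supported. *)
Definition seriesT (s : bool) : mfield M := if s then Tminus rho else Tplus rho.

Lemma hraise_series s i j : hraise 0 (seriesT s i j).
Proof. by case: s; [exact: hraise_Tminus|exact: hraise_Tplus]. Qed.

Lemma series_unipotent s i : hraise 1 (fsub fone (seriesT s i i)).
Proof.
by case: s; [have := Tminus_unipotent i i|have := Tplus_unipotent i i]; rewrite /mone eqxx.
Qed.

Lemma series_off s i j : i != j -> hraise 1 (seriesT s i j).
Proof.
move=> /negPf ij n w m hw; case: s => /=.
  rewrite TminusE /mone ij add0r; exact: (hraise_h (@hraise_tpart _ _ _)).
rewrite TplusE /mone ij sub0r; apply: hdvdN; exact: (hraise_h (@hraise_tpart _ _ _)).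
Qed.

Lemma supp_series s i j : supp_in (cone s) (seriesT s i j).
Proof. by case: s; [exact: supp_Tminus|exact: supp_Tplus]. Qed.

Lemma series_D s i j x y m :
  seriesT s i j (x + y) m = seriesT s i j x m + seriesT s i j y m.
Proof.
by case: s => /=; rewrite !(TminusE, TplusE) tpart_D mone_D scalerDr ?opprD addrACA.
Qed.

Let o1 := ord0 : 'I_2.
Let o2 := ord_max : 'I_2.

Lemma series_diff i j w m : i != j ->
  seriesT false i j w m - seriesT true i j w m =
  - (hvar *: rho (dyt K i j (- m - 1)) w).
Proof.
move=> /negPf ij; rewrite /= TplusE TminusE /mone ij sub0r add0r /tpart /neg /nonneg.
by rewrite /= ltNge; case: (0 <= m) => /=; rewrite scaler0 oppr0 ?add0r ?addr0.
Qed.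

(** As t_12 is divisible by h, the inverse of t_11 and the shifts by h/4 only
    matter modulo h^2. *)
Lemma Xplus_mod w m :
  hdvd 2 (Xplus rho w m + hvar *: rho (dyt K o1 o2 (- m - 1)) w).
Proof.
have half s a : hdvd 2 ((finv (fshift a (seriesT s o1 o1)) **
    fshift a (seriesT s o1 o2)) w m - seriesT s o1 o2 w m).
  apply: (@hdvd_trans _ _ _ _ (fshift a (seriesT s o1 o2) w m)); last first.
    by apply: fshift_mod2 => // p _; apply: hraise_hdvd; exact: series_off.
  apply: (@finv_comp_mod _ _ hM s); try apply: supp_fshift => //; try exact: supp_series.
  - by apply: hraise_fshift; exact: hraise_series.
  - by apply: fshift_unipotent => //; [exact: hraise_series|exact: series_unipotent].
  - by apply: hraise_fshift; exact: series_off.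
have := hdvd_eqB (half false (- 4^-1)) (half true 4^-1).
by rewrite (series_diff (i := o1) (j := o2)) // opprK.
Qed.

(** For X^-, the inverse of t_11 acts first, and the additivity of t_21 is
    needed to discard its terms divisible by h. *)
Lemma Xminus_mod w m :
  hdvd 2 (Xminus rho w m + hvar *: rho (dyt K o2 o1 (- m - 1)) w).
Proof.
have half s a : hdvd 2 ((fshift a (seriesT s o2 o1) **
    finv (fshift a (seriesT s o1 o1))) w m - seriesT s o2 o1 w m).
  apply: (@comp_finv_mod _ _ hM s); try apply: supp_fshift => //; try exact: supp_series.
  - by apply: hraise_fshift; exact: hraise_series.
  - by apply: fshift_unipotent => //; [exact: hraise_series|exact: series_unipotent].
  - by apply: hraise_fshift; exact: hraise_series.
  - exact: series_off.
  - exact: series_D.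
  - by move=> x j; apply: fshift_mod2 => // p _; apply: hraise_hdvd; exact: series_off.
have := hdvd_eqB (half false 4^-1) (half true (- 4^-1)).
by rewrite (series_diff (i := o2) (j := o1)) // opprK.
Qed.

(** The correction t_21 t_11^-1 t_12 has two factors divisible by h. *)
Lemma kseries_mod s j w m : hdvd 2 (kseries (seriesT s) j w m - seriesT s j j w m).
Proof.
rewrite /kseries; case: (eqVneq j o1) => [->|ne]; first by rewrite subrr; exact: hdvd0.
rewrite (_ : j = o2); last by move: ne; case: j => [[|[|]]] // ? ?; apply: val_inj.
rewrite /fsub addrAC subrr sub0r; apply: hdvdN.
have : hraise 2 (seriesT s o2 o1 ** finv (seriesT s o1 o1) ** seriesT s o1 o2).
  rewrite -[2%N]/((1 + 0) + 1)%N; apply: hraise_fcomp; last exact: series_off.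
  apply: hraise_fcomp; first exact: series_off.
  by apply: hraise_finv; exact: hraise_series.
exact: hraise_hdvd.
Qed.

(** Meant for r1 = - h t^(0), the coefficient of u^-1 of T^+(u). *)
Lemma comm_cancel (r1 r2 t : M -> M) w x :
  (forall y, r1 y = - (hvar *: t y)) ->
  (forall y, r2 (- (hvar *: y)) = - (hvar *: r2 y)) ->
  r1 (r2 w) - r2 (r1 w) + hvar *: x = 0 -> t (r2 w) - r2 (t w) = x.
Proof.
move=> r1E r2E; rewrite !r1E r2E opprK -scalerN -!scalerDr => /(hc_inj hM)/eqP.
by rewrite addrC addr_eq0 opprD opprK => /eqP ->.
Qed.

(** The relation of [rtt_zero_mode] in a module, where h can be cancelled. *)
Lemma Tplus_commutator i j k l m w :
  rho (dyt K i k 0) (Tplus rho j l w m) - Tplus rho j l (rho (dyt K i k 0) w) m =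
  (if j == k then Tplus rho i l w m else 0) - (if i == l then Tplus rho j k w m else 0).
Proof.
have pos i' j' m' : 0 < m' -> tplus K i' j' m' = 0 by case: m' => [[|m']|m'].
have R0 : rel_ideal (dy_rel K) (rtt_lhs 0 (@tplus K) (@tplus K) i j k l (-1) m -
    rtt_rhs 0 (@tplus K) (@tplus K) i j k l (-1) m).
  by move=> J hJ; apply; left; left; right; exists i, j, k, l, (-1), m.
have := act_0 w; rewrite -(_ : pproj (dy_rel K) (rtt_lhs 0 (@tplus K) (@tplus K) i j k l (-1) m -
    rtt_rhs 0 (@tplus K) (@tplus K) i j k l (-1) m) = 0); last by apply: pprojP; rewrite subr0.
rewrite rtt_zero_mode // {R0}.
have aif (c : bool) (x : hps (free_alg K (dy_gen))) v :
    rho (pproj (dy_rel K) (if c then x else 0)) v =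
    if c then rho (pproj (dy_rel K) x) v else 0.
  by case: c => //; exact: act_0.
have E (x y z t : hps (free_alg K (dy_gen))) (c d : bool) v :
    rho (pproj (dy_rel K) ((x * y - y * x) +
      hvar *: ((if c then z else 0) - (if d then t else 0)))) v =
    (rho (pproj (dy_rel K) x) (rho (pproj (dy_rel K) y) v) -
     rho (pproj (dy_rel K) y) (rho (pproj (dy_rel K) x) v)) +
    hvar *: ((if c then rho (pproj (dy_rel K) z) v else 0) -
             (if d then rho (pproj (dy_rel K) t) v else 0)).
  apply: etrans (pactD _ _ _) _; congr (_ + _).
    apply: etrans (pactD _ _ _) _; congr (_ + _); first exact: pactM.
    by apply: etrans (pactN _ _) _; congr (- _); exact: pactM.
  apply: etrans (pactZ _ _ _) _; congr (_ *: _).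
  apply: etrans (pactD _ _ _) _; congr (_ + _); first exact: aif.
  by apply: etrans (pactN _ _) _; congr (- _); exact: aif.
rewrite E {E aif}.
have e z : rho (pproj (dy_rel K) (tplus K i k (-1))) z = - (hvar *: rho (dyt K i k 0) z).
  by rewrite [tplus _ _ _ _]/= pprojN pprojZ act_N act_Z.
apply: (comm_cancel (r1 := rho (pproj (dy_rel K) (tplus K i k (-1)))) e) => z.
by rewrite actr_N actr_Z.
Qed.
End DYModule.

Lemma ord2_cases (i : 'I_2) : i = ord0 \/ i = ord_max.
Proof. by case: i => [[|[|]]] // hi; [left|right]; apply: val_inj. Qed.

Section OneLetterVertex.
Variables (K : fieldType) (M : lmodType (hps K)).
Hypothesis hM : hcomplete M.
Variable rho : amodule (dy_rel K) M.
Implicit Types (w x y : M) (m : int) (i j k : 'I_2) (q : nat).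

(** All entries of T^+ inherit truncation from t_11^+, being combinations of it
    and its brackets with zero modes. *)
Lemma hlaurent_Tplus : hlaurent (Tplus rho ord0 ord0) ->
  forall i j, hlaurent (Tplus rho i j).
Proof.
have bracket i k j l : hlaurent (Tplus rho j l) ->
    hlaurent (fun w m => rho (dyt K i k 0) (Tplus rho j l w m) -
                         Tplus rho j l (rho (dyt K i k 0) w) m).
  move=> h w n; have [N hN] := h w n; have [N' hN'] := h (rho (dyt K i k 0) w) n.
  exists (Order.min N N') => m hm; apply: hdvdB; last by apply: hN'; lia.
  by apply: actr_hdvd; apply: hN; lia.
move=> h00.
have h10 : hlaurent (Tplus rho ord_max ord0).
  move=> w n; have [N hN] := bracket ord_max ord0 _ _ h00 w n; exists N => m /hN.
  by rewrite (Tplus_commutator hM) /= subr0.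
have h01 : hlaurent (Tplus rho ord0 ord_max).
  move=> w n; have [N hN] := bracket ord0 ord_max _ _ h00 w n; exists N => m /hN/hdvdN.
  by rewrite (Tplus_commutator hM) /= sub0r opprK.
have h11 : hlaurent (Tplus rho ord_max ord_max).
  move=> w n; have [N hN] := bracket ord_max ord0 _ _ h01 w n.
  have [N' hN'] := h00 w n.
  exists (Order.min N N') => m hm.
  have /hN : m < N by lia.
  rewrite (Tplus_commutator hM) /= => hB; apply: hdvd_subr hB.
  by apply: hN'; lia.
by move=> i j; case: (ord2_cases i) => ->; case: (ord2_cases j) => ->.
Qed.

Hypothesis Tlau : forall i j, hlaurent (Tplus rho i j).

(** 1 - T^+(u), whose powers make up the inverse of T^+(u). *)
Definition oneT : mfield M := msub (@mone K M) (Tplus rho).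

Lemma hraise_oneT i j : hraise 1 (oneT i j).
Proof. exact: Tplus_unipotent. Qed.

Lemma supp_oneT i j : supp_in (cone false) (oneT i j).
Proof. by apply: supp_fsub; [exact: supp_mone|exact: supp_Tplus]. Qed.

Lemma hlaurent_mone i j : hlaurent (@mone K M i j).
Proof.
rewrite /mone; case: eqP => _; first exact: hlaurent_fone.
by move=> w n; exists 0 => m _; exact: hdvd0.
Qed.

Lemma hlaurent_oneT i j : hlaurent (oneT i j).
Proof.
move=> w n; have [N hN] := Tlau i j w n; have [N' hN'] := hlaurent_mone i j w n.
by exists (Order.min N N') => m hm; apply: hdvdB; [apply: hN'|apply: hN]; lia.
Qed.

Lemma mpow_oneT q i j :
  [/\ hraise q (mpow oneT q i j), supp_in (cone false) (mpow oneT q i j)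
    & hlaurent (mpow oneT q i j)].
Proof.
elim: q i j => [|q IHq] i j.
  by split; [exact: hraise_mone|exact: supp_mone|exact: hlaurent_mone].
split.
- move=> n w m hw; apply: hdvd_sum => l _; have [r _ _] := IHq l j.
  by rewrite -add1n; apply: (hraise_fcomp (@hraise_oneT i l) r).
- move=> w m hm; apply: big1 => l _; have [r s _] := IHq l j.
  apply: (supp_fcomp hM (P := cone false)) => //; first exact: (@coneD false).
  - exact: hraiseW (@hraise_oneT i l).
  - exact: supp_oneT.
- move=> w n; have /choice[g hg] l : exists N : int, forall m, m < N ->
      hdvd n (fcomp (oneT i l) (mpow oneT q l j) w m).
    have [r s la] := IHq l j; apply: hlaurent_fcomp => //.
    - exact: hraiseW (@hraise_oneT i l).
    - exact: hlaurent_oneT.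
  exists (Order.min (g ord0) (g ord_max)) => m hm; apply: hdvd_sum => l _; apply: hg.
  by case: (ord2_cases l) => ->; lia.
Qed.

Lemma supp_minv i j : supp_in (cone false) (minv (Tplus rho) i j).
Proof. by apply: supp_fsum => // q; have [_ s _] := mpow_oneT q i j. Qed.

Lemma hlaurent_minv i j : hlaurent (minv (Tplus rho) i j).
Proof. by apply: hlaurent_fsum => q; have [r s l] := mpow_oneT q i j. Qed.

(** Modulo h^2 only the first two terms 1 and 1 - T^+ of the geometric series
    remain. *)
Lemma minv_mod i j w m :
  hdvd 2 (minv (Tplus rho) i j w m - (@mone K M i j w m + hvar *: tpart rho neg i j w m)).
Proof.
have hs : hsummable (fun q => mpow oneT q i j w m).
  apply: (@nat_hsummable_sub _ _ _ 0) => q; rewrite subn0.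
  by have [r _ _] := mpow_oneT q i j; exact: hraise_hdvd r.
have := hsum_nat (n := 2) (m := 2) hM hs.
rewrite big_ord_recl big_ord1 [X in X + _]/= [mpow _ (lift _ _) _ _ _ _]/=.
have -> : mcomp oneT (@mone K M) i j w m = hvar *: tpart rho neg i j w m.
  rewrite /mcomp (bigD1 j) //= big1 ?addr0 => [|l /negPf lj]; last first.
    rewrite /mone lj; apply: hsum_eq0 => // k.
    exact: (hraise_at0 hM _ (@hraise_oneT i l)).
  rewrite /mone eqxx fcomp_fone_r //; last exact: hraiseW (@hraise_oneT i j).
  by rewrite /oneT /msub /fsub TplusE opprB addrC subrK.
by apply=> q q2; have [r _ _] := mpow_oneT q i j; exact: hdvdW q2 (hraise_hdvd _ _ r).
Qed.

(** T^+(z - h/2)^-1, the right factor of the vertex operators. *)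
Definition invT i j := fshift (- 2^-1) (minv (Tplus rho) i j).

Lemma hdvd1_off0 i j w m : m != 0 -> hdvd 1 (minv (Tplus rho) i j w m).
Proof.
move=> /negPf m0; have := hdvdW (ltnW (ltnSn 1)) (minv_mod i j w m).
apply: hdvd_subr; rewrite /mone; apply: hdvdD; last exact: hdvdhZ (hdvd0n _).
by case: eqP => _; rewrite ?foneE ?m0; exact: hdvd0.
Qed.

Lemma invT_mod i j w m :
  hdvd 2 (invT i j w m - (@mone K M i j w m + hvar *: tpart rho neg i j w m)).
Proof.
apply: hdvd_trans (minv_mod i j w m); apply: fshift_mod2 => // p; exact: hdvd1_off0.
Qed.

Lemma invT_mod1 i j w m : hdvd 1 (invT i j w m - @mone K M i j w m).
Proof.
apply: hdvd_trans (hdvdW (ltnW (ltnSn 1)) (invT_mod i j w m)) _.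
by rewrite addrAC subrr add0r; exact: hdvdhZ (hdvd0n _).
Qed.

(** T^-(z) T^+(z)^-1 = 1 + h sum_r t^(r) z^(-r-1) modulo h^2: the negative
    powers of z come from the inverse of T^+, the others from T^-. *)
Lemma Tminus_invT_mod i a k w m :
  hdvd 2 ((Tminus rho i a ** invT a k) w m -
     ((if i == a then invT a k w m else 0) +
      (if a == k then hvar *: tpart rho nonneg i a w m else 0))).
Proof.
have hs : hsummable (fun p => Tminus rho i a (invT a k w p) (m - p)).
  apply: fcomp_hsummable_laurent => //; first exact: hraise_Tminus.
  - by apply: hlaurent_fshift; exact: hlaurent_minv.
  - by apply: supp_fshift => //; exact: supp_minv.
pose G p := (if (i == a) && (p == m) then invT a k w m else 0) +
  (if (a == k) && (p == 0) then hvar *: tpart rho nonneg i a w m else 0).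
have FG p : hdvd 2 (Tminus rho i a (invT a k w p) (m - p) - G p).
  rewrite TminusE /G; apply: hdvd_eqD.
    rewrite /mone; case: eqP => /= _; last by rewrite subrr; exact: hdvd0.
    rewrite foneE subr_eq0 eq_sym; case: eqP => [->|_]; rewrite subrr; exact: hdvd0.
  (* Modulo h, invT is the identity matrix. *)
  have h1 := hraise_tpart rho nonneg i a (m - p) (invT_mod1 a k w p).
  have TD := tpart_D rho nonneg i a (invT a k w p - @mone K M a k w p) (@mone K M a k w p) (m - p).
  rewrite subrK in TD; have {h1} := hdvdhZ h1.
  rewrite -[X in hvar *: X](addrK (tpart rho nonneg i a (@mone K M a k w p) (m - p))) -TD scalerBr.
  congr (hdvd 2 (_ - _)); rewrite /mone; have t0 : tpart rho nonneg i a 0 (m - p) = 0.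
    exact: (hraise_at0 hM _ (@hraise_tpart _ _ _ _ _ _)).
  case: eqP => /= _; last by rewrite t0 scaler0.
  rewrite foneE; case: eqP => [->|_]; first by rewrite subr0.
  by rewrite t0 scaler0.
have := hsum_fset (n := 2) (J := [fset m; 0]%fset) hM hs.
move=> h; apply: hdvd_trans (h _) _ => [p|].
  rewrite !inE negb_or => /andP[/negPf pm /negPf p0]; have := FG p.
  by rewrite /G pm p0 !andbF addr0 subr0.
have GE : \sum_(p <- [fset m; 0]%fset) G p =
    (if i == a then invT a k w m else 0) +
    (if a == k then hvar *: tpart rho nonneg i a w m else 0).
  have [m0|m0] := eqVneq m 0.
    have -> : [fset m; 0]%fset = [fset 0]%fset by apply/fsetP => x; rewrite !inE m0 orbb.
    by rewrite big_seq_fset1 /G m0 (eqxx (0 : int)) !andbT.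
  rewrite big_fsetU1 ?inE //= big_seq_fset1 /G (eqxx m) (eqxx (0 : int)) (eq_sym 0 m) (negPf m0).
  by rewrite !andbT !andbF addr0 add0r.
by rewrite -GE -sumrB; apply: hdvd_sum => p _; exact: FG.
Qed.

Lemma fder0 (A : zfield M) : fder 0 A = A.
Proof.
apply/funext => w; apply/funext => m.
by rewrite /fder gbin0 hconst1 scale1r addr0.
Qed.

Lemma vertex_rhs_mod i k w m :
  hdvd 2 (vertex_rhs (Tminus rho) invT [:: (i, k, 0%N)] w m -
     (@mone K M i k w m + hvar *: rho (dyt K i k (- m - 1)) w)).
Proof.
have -> : vertex_rhs (Tminus rho) invT [:: (i, k, 0%N)] w m =
    \sum_(a < 2) (Tminus rho i a ** invT a k) w m.
  rewrite /=; apply: eq_bigr => a _; rewrite big_ord1 !fder0.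
  congr fcomp; apply/funext => x; apply/funext => p; apply: fcomp_fone_r => //.
  exact: hraise_Tminus.
have sumE : \sum_(a < 2) ((if i == a then invT a k w m else 0) +
      (if a == k then hvar *: tpart rho nonneg i a w m else 0)) =
    invT i k w m + hvar *: tpart rho nonneg i k w m.
  rewrite big_split /=; congr (_ + _).
    rewrite (bigD1 i) //= eqxx big1 ?addr0 // => a ha.
    by rewrite eq_sym (negPf ha).
  by rewrite (bigD1 k) //= eqxx big1 ?addr0 // => a /negPf ->.
apply: (@hdvd_trans _ _ _ _ (invT i k w m + hvar *: tpart rho nonneg i k w m)).
  by rewrite -sumE -sumrB; apply: hdvd_sum => a _; exact: Tminus_invT_mod.
have -> : hvar *: rho (dyt K i k (- m - 1)) w =
    hvar *: tpart rho neg i k w m + hvar *: tpart rho nonneg i k w m.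
  rewrite /tpart /neg /nonneg /= ltNge; case: (0 <= m) => /=; rewrite scaler0 ?add0r ?addr0 //.
rewrite addrA; apply: hdvd_eqD; first exact: invT_mod.
by rewrite subrr; exact: hdvd0.
Qed.
End OneLetterVertex.

(** * The bosonic fields modulo h^2 *)

Section HConst.
Variable K : comNzRingType.

Lemma hconstD (V : zmodType) : {morph @hconst V : a b / a + b}.
Proof. by move=> a b; apply: hpsP => -[|n] //; rewrite hpsDE /= addr0. Qed.

Lemma hconstN (V : zmodType) : {morph @hconst V : a / - a}.
Proof. by move=> a; apply: hpsP => -[|n] //; change (0 = - 0 :> V); rewrite oppr0. Qed.

Lemma hconstM : {morph @hconst K : a b / a * b}.
Proof.
move=> a b; apply: hpsP => -[|n]; first by rewrite hpsME big_ord1.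
by rewrite hpsME big_ord_recl /= mulr0 add0r big1 // => i _; rewrite mul0r.
Qed.

Lemma hconstZ (V : lmodType K) (a : K) (x : V) : hconst a *: hconst x = hconst (a *: x).
Proof.
apply: hpsP => -[|n]; first by rewrite hpsZE big_ord1.
by rewrite hpsZE big_ord_recl /= scaler0 add0r big1 // => i _; rewrite scale0r.
Qed.

Lemma hconst0 (V : zmodType) : hconst 0 = 0 :> hps V.
Proof. by apply: hpsP => -[]. Qed.

Lemma hconstZE (V : lmodType K) (a : K) (x : hps V) d : (hconst a *: x) d = a *: x d.
Proof.
rewrite hpsZE big_ord_recl subn0 big1 ?addr0 // => i _.
by rewrite /hconst /= scale0r.
Qed.
End HConst.

Section Exponents.
Variables (K : fieldType) (M : lmodType (hps K)).
Hypothesis hM : hcomplete M.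
Implicit Types (a b : K) (p m : int).

Lemma pow_shift_pred a p : pow_shift a p (p - 1) = hconst (p%:~R * a) * hvar.
Proof. by rewrite /pow_shift opprB addrC subrK /= gbin1 !expr1. Qed.

Lemma hdvd_pow_shiftB a b p m n (x : M) : hdvd n x ->
  hdvd (`|p - m| + n) ((pow_shift a p m - pow_shift b p m) *: x).
Proof. by move=> hx; rewrite scalerBl; apply: hdvdB; exact: hdvd_pow_shift. Qed.

Lemma pow_shiftB_diag a b p : pow_shift a p p - pow_shift b p p = 0.
Proof. by rewrite !pow_shift_diag subrr. Qed.

Lemma pow_shiftB_lt a b p m : p < m -> pow_shift a p m - pow_shift b p m = 0.
Proof. by move=> h; rewrite !pow_shift_lt // subrr. Qed.

Lemma hraise_pow_shiftB a b p m n (x : M) : hdvd n x ->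
  hdvd n.+1 ((pow_shift a p m - pow_shift b p m) *: x).
Proof.
move=> hx; have [->|ne] := eqVneq p m.
  by rewrite pow_shiftB_diag scale0r; exact: hdvd0.
by apply: hdvdW (hdvd_pow_shiftB a b p m hx); lia.
Qed.

Lemma pow_shift2_diag N (a p b q : K) : pow_shift2 N a p b q N = 1.
Proof. by rewrite /pow_shift2 subrr /= big_ord1 subnn !gbin0 !expr0 !mulr1 hconst1. Qed.

Lemma pow_shift2_gt N (a p b q : K) m : N < m -> pow_shift2 N a p b q m = 0.
Proof. by rewrite /pow_shift2; case e: (N - m) => [k|k] // h; lia. Qed.

Lemma hdvd_pow_shift2 N (a p b q : K) m n (x : M) : hdvd n x ->
  hdvd (`|N - m| + n) (pow_shift2 N a p b q m *: x).
Proof.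
rewrite /pow_shift2 => hx; case: (N - m) => k; last by rewrite scale0r; exact: hdvd0.
by rewrite -scalerA; apply: hdvdZ; exact: hdvdXZ.
Qed.

Lemma pow_shift2_pred (a p b q : K) :
  pow_shift2 0 a p b q (-1) = hconst (p * a + q * b) * hvar.
Proof.
rewrite /pow_shift2 /= big_ord_recl big_ord1 /= !gbin0 !gbin1 !expr0 !expr1.
by rewrite !mulr1 !mul1r addrC.
Qed.

(** The exponents of k_j^+ and k_j^- have the common form
    sum_p p^-1 ((z + a h)^p - (z + b h)^p) f_p with a - b = 1, and are therefore
    h sum_p f_p z^(p-1) modulo h^2. *)
Section Exponent.
Variables (a b : K) (p : nat -> int) (c : nat -> K) (f : nat -> M -> M).
Hypotheses (ab : a - b = 1) (pinj : injective p)
  (cp : forall r, c r * (p r)%:~R = 1)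
  (fh : forall r n x, hdvd n x -> hdvd n (f r x)).

Definition expo : zfield M := fsum (fun r =>
  fun w m => (hconst (c r) * (pow_shift a (p r) m - pow_shift b (p r) m)) *: f r w).

Lemma hraise_expo : hraise 1 expo.
Proof.
move=> n w m hw; apply: hsum_hdvd => r; rewrite -scalerA; apply: hdvdZ.
by apply: hraise_pow_shiftB; exact: fh.
Qed.

Lemma expo_summable w m :
  hsummable (fun r => (hconst (c r) * (pow_shift a (p r) m - pow_shift b (p r) m)) *: f r w).
Proof.
move=> n; pose g k : option nat :=
  if pselect (exists r, p r = k) is left e then Some (sval (cid e)) else None.
exists [fset r in pmap g (int_range (n + `|m|))]%fset => r; rewrite !inE /= => hr.
rewrite -scalerA; apply: hdvdZ.
have {hr} : (n + `|m| < `|p r|)%N.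
  rewrite ltnNge; apply: contra hr => hr; rewrite mem_pmap; apply/mapP; exists (p r).
    by rewrite in_int_range.
  rewrite /g; case: pselect => [e|[]]; last by exists r.
  by congr Some; apply: pinj; rewrite (svalP (cid e)).
by move=> h; apply: hdvdW (hdvd_pow_shiftB a b (p r) m (hdvd0n _)); lia.
Qed.

Lemma expo_mod r w : hdvd 2 (expo w (p r - 1) - hvar *: f r w).
Proof.
have := hsum1 (n := 2) (i0 := r) hM (@expo_summable w (p r - 1)).
rewrite /= !pow_shift_pred -mulrBl -hconstN -hconstD -mulrBr ab mulr1 mulrA.
rewrite -hconstM cp hconst1 mul1r.
apply=> r' ne; rewrite -scalerA; apply: hdvdZ.
have {}ne : p r' != p r by apply: contra ne => /eqP/pinj/eqP.
have [lt|] := ltP (p r') (p r - 1).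
  by rewrite pow_shiftB_lt // scale0r; exact: hdvd0.
rewrite le_eqVlt => /orP[/eqP <-|lt]; first by rewrite pow_shiftB_diag scale0r; exact: hdvd0.
by apply: hdvdW (hdvd_pow_shiftB a b (p r') _ (hdvd0n _)); lia.
Qed.

Lemma expo_mod0 m w : (forall r, p r != m + 1) -> hdvd 2 (expo w m).
Proof.
move=> hm; apply: hsum_hdvd => r; rewrite -scalerA; apply: hdvdZ.
have := hm r; have [lt|] := ltP (p r) m.
  by rewrite pow_shiftB_lt // scale0r => _; exact: hdvd0.
rewrite le_eqVlt => /orP[/eqP <- _|lt ne]; first by rewrite pow_shiftB_diag scale0r; exact: hdvd0.
by apply: hdvdW (hdvd_pow_shiftB a b (p r) _ (hdvd0n _)); lia.
Qed.

Lemma supp_expo : (forall r, p r < 0) -> supp_in (cone false) expo.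
Proof.
move=> pneg w m; rewrite /cone -ltNge => m0; apply: hsum_eq0 => // r.
by rewrite pow_shiftB_lt ?mulr0 ?scale0r //; exact: lt_trans (pneg r) m0.
Qed.

Lemma hlaurent_expo : (forall w n, exists r0, forall r, (r0 <= r)%N -> hdvd n (f r w)) ->
  hlaurent expo.
Proof.
move=> hf w n; have [r0 hr0] := hf w n.
have [B hB] : exists B : nat, forall r, (r < r0)%N -> (`|p r| <= B)%N.
  elim: r0 {hr0} => [|r0 [B hB]]; first by exists 0%N.
  exists (maxn `|p r0| B) => r; rewrite ltnS leq_eqVlt => /orP[/eqP ->|/hB]; lia.
exists (- (B + n)%N%:Z) => m hm; apply: hsum_hdvd => r.
have [lt|/hr0 h] := ltnP r r0; last by apply: hdvdZ.
have := hB r lt => hp; rewrite -scalerA; apply: hdvdZ.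
by apply: hdvdW (hdvd_pow_shiftB a b (p r) _ (hdvd0n _)); lia.
Qed.
End Exponent.
End Exponents.

Section FockSpace.
Variable K : fieldType.
Hypothesis char0 : forall n : nat, n.+1%:R != 0 :> K.
Implicit Types (k : fock_key) (x y : fock0 K) (w : Fock K) (j : 'I_2) (m n : int).

Let hF : hcomplete (Fock K) := hps_hcomplete (fock0 K).

(** The action of [fock_ext f] on each coefficient of h. *)
Definition lext (f : fock_key -> fock0 K) x : fock0 K :=
  \sum_(k <- msupp x) x@_k *: f k.

Lemma lextEw f x (D : {fset fock_key}) : (msupp x `<=` D)%fset ->
  lext f x = \sum_(k <- D) x@_k *: f k.
Proof.
move=> sD; rewrite /lext [RHS](big_fsetID _ (fun k => k \in msupp x)) /=.
rewrite [X in _ + X]big1_seq ?addr0 => [|k]; last first.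
  by rewrite !inE /= => /andP[_ /mcoeff_outdom ->]; rewrite scale0r.
congr (\sum_(i <- _) _); apply: congr1; apply/fsetP => k; rewrite !inE /=.
by case: (boolP (k \in msupp x)) => [/(fsubsetP sD) ->|]; rewrite ?andbF.
Qed.

Lemma lextU f c k : lext f << c *g k >> = c *: f k.
Proof.
rewrite (@lextEw f _ [fset k]%fset) ?msuppU_le // big_seq_fset1.
by rewrite mcoeffUU.
Qed.

Lemma fock_extE f w d : fock_ext f w d = lext f (w d). Proof. by []. Qed.

Lemma lext0 f : lext f 0 = 0.
Proof. by rewrite /lext msupp0 big_seq_fset0. Qed.

Lemma hdvd_fock_ext f d w : hdvd d w -> hdvd d (fock_ext f w : Fock K).
Proof. by move=> /hdvdP h; apply/hdvdP => e /h; rewrite fock_extE => ->; exact: lext0. Qed.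

Lemma hraise_fock_a j r d w : hdvd d w -> hdvd d (fock_a j r w).
Proof. by case: r => [[|r]|r] h; [exact: hdvd0| |]; exact: hdvd_fock_ext. Qed.

Definition bvec k : Fock K := hconst << k >>.

Lemma fock_ext_bvec f k : fock_ext f (bvec k) = hconst (f k).
Proof.
apply: hpsP => -[|d]; rewrite fock_extE /bvec /hconst /=; last exact: lext0.
by rewrite lextU scale1r.
Qed.

(** The effect of a_j(r+1) and a_j(-r-1) on monomials: the variable (j, r)
    stands for a_j(-(r+1)). *)
Definition lower j r k : fock0 K :=
  << (r.+1 * k.1 (j, r))%:R *g (divcm k.1 (ucm (j, r)), k.2) >>.
Definition raise j r k : fock0 K := << (mulcm (ucm (j, r)) k.1, k.2) >>.

Lemma fock_a_bvec_pos j r k : fock_a j r.+1%:Z (bvec k) = hconst (lower j r k).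
Proof. exact: fock_ext_bvec. Qed.

Lemma fock_a_bvec_neg j r k : fock_a j (- r.+1%:Z) (bvec k) = hconst (raise j r k).
Proof. exact: fock_ext_bvec. Qed.

(** Modulo h^d a vector involves finitely many variables. *)
Lemma fock_a_small j w d : exists r0, forall r, (r0 <= r)%N ->
  hdvd d (fock_a j r.+1%:Z w).
Proof.
elim: d => [|d [r0 hr0]]; first by exists 0%N => r _; exact: hdvd0n.
pose r1 := (\max_(k <- msupp (w d)) \max_(v <- finsupp k.1) v.2.+1)%N.
exists (maxn r0 r1) => r; rewrite geq_max => /andP[/hr0 /hdvdP h hr1].
apply/hdvdP => e; rewrite ltnS leq_eqVlt => /orP[/eqP ->|/h //].
rewrite /fock_a fock_extE /lext big1_seq // => k /= hk.
suff -> : k.1 (j, r) = 0%N by rewrite muln0 monalgU0 scaler0.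
apply/eqP; rewrite cmE_eq0; apply/negP => hv.
suff : (r < r1)%N by rewrite ltnNge hr1.
apply: leq_trans (leq_bigmax_seq _ hk isT).
by have := @leq_bigmax_seq _ _ xpredT (fun v : 'I_2 * nat => v.2.+1) _ hv isT.
Qed.

Lemma fock_diag_bvec (s : int -> int -> hps K) k m :
  fock_diag s (bvec k) m = s k.2 m *: bvec k.
Proof.
rewrite /fock_diag (hsum_single hF (i0 := k.2)) => [|p hp].
  by rewrite fock_ext_bvec eqxx.
by rewrite fock_ext_bvec eq_sym (negPf hp) hconst0 scaler0.
Qed.

Section Shifted.
Variables (a b : K) (N : int -> int) (e e' : int -> K).
Let s n := pow_shift2 (N n) a (e n) b (e' n).

Lemma supp_fock_diag : (forall n, N n <= 0) -> supp_in (cone false) (fock_diag s : zfield (Fock K)).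
Proof.
move=> hN w m; rewrite /cone -ltNge => m0; apply: (hsum_eq0 hF) => p.
by rewrite /s pow_shift2_gt ?scale0r //; exact: le_lt_trans (hN p) m0.
Qed.

Lemma hlaurent_fock_diag : (forall n, N n = 0) -> hlaurent (fock_diag s : zfield (Fock K)).
Proof.
move=> hN w d; exists (- d%:Z) => m hm; apply: hsum_hdvd => p.
by rewrite /s hN; apply: hdvdW (hdvd_pow_shift2 _ _ _ _ _ _ (hdvd0n _)); lia.
Qed.

Lemma fcomp_diag_summable A k m : hraise 0 A ->
  hsummable (fun p => A (fock_diag s (bvec k) p) (m - p) : Fock K).
Proof.
move=> pA d; exists (int_range (`|N k.2| + d)) => p; rewrite in_int_range fock_diag_bvec => hp.
have [lt|le] := ltP (N k.2) p.
  by rewrite /s pow_shift2_gt // scale0r (hraise_at0 hF _ pA); exact: hdvd0.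
by apply: pA; apply: hdvdW (hdvd_pow_shift2 _ _ _ _ _ _ (hdvd0n _)); lia.
Qed.

(** The top power of z in the scalar factor has coefficient 1, and the others
    are divisible by h. *)
Lemma fcomp_diag_mod A k : hraise 0 A ->
  hdvd 1 ((A ** fock_diag s) (bvec k) (N k.2) - A (bvec k) 0).
Proof.
move=> pA; have := hsum1 (n := 1) (i0 := N k.2) hF (@fcomp_diag_summable A k (N k.2) pA).
rewrite /= subrr fock_diag_bvec /s pow_shift2_diag scale1r; apply=> p ne.
rewrite fock_diag_bvec /s; have [lt|le] := ltP (N k.2) p.
  by rewrite pow_shift2_gt // scale0r (hraise_at0 hF _ pA); exact: hdvd0.
apply: pA; apply: hdvdW (hdvd_pow_shift2 _ _ _ _ _ _ (hdvd0n _)).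
by move: (N k.2) ne le => c ne le; lia.
Qed.
End Shifted.

(** ** The series k_j^+ and k_j^- *)

Variable i : 'I_2.

Let halfD : 2^-1 - (- 2^-1) = 1 :> K.
Proof. by have := char0 1; rewrite opprK => h; field. Qed.

Let pp (r : nat) : int := - r.+1%:Z.
Let pm (r : nat) : int := r.+1%:Z.
Let ppinj : injective pp. Proof. by move=> r r'; rewrite /pp; lia. Qed.
Let pminj : injective pm. Proof. by move=> r r'; rewrite /pm; lia. Qed.
Let cp r : - (r.+1)%:R^-1 * (pp r)%:~R = 1 :> K.
Proof. by rewrite /pp mulrNz mulrN mulNr opprK mulVf. Qed.
Let cm r : (r.+1)%:R^-1 * (pm r)%:~R = 1 :> K.
Proof. by rewrite /pm mulVf. Qed.

Let Bplus j : zfield (Fock K) :=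
  expo 2^-1 (- 2^-1) pp (fun r => - (r.+1)%:R^-1) (fun r => fock_a j r.+1%:Z).

Let fplus j r d w : hdvd d w -> hdvd d (fock_a j r.+1%:Z w).
Proof. exact: hraise_fock_a. Qed.

Let fminus j r d w : hdvd d w -> hdvd d (fock_a j (- r.+1%:Z) w).
Proof. exact: hraise_fock_a. Qed.

Lemma kplusE j : kplus i j = fexp (Bplus j) **
  fock_diag (fun n => pow_shift2 0 4^-1 (ev K i n)
    (if j == ord0 then 5 / 4 else - (3 / 4)) (- ev K i n)).
Proof. by []. Qed.

Lemma hlaurent_kplus j : hlaurent (kplus i j : zfield (Fock K)).
Proof.
have rB : hraise 1 (Bplus j) by apply: hraise_expo; exact: fplus.
have lB : hlaurent (Bplus j).
  by apply: hlaurent_expo => w d; exact: fock_a_small.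
have sB : supp_in (cone false) (Bplus j) by apply: (supp_expo hF) => r; rewrite /pp; lia.
rewrite kplusE; apply: (hlaurent_fcomp hF).
- by apply: hraise_fexp; exact: hraiseW rB.
- exact: (hlaurent_fexp hF).
- exact: hlaurent_fock_diag.
- exact: supp_fock_diag.
Qed.

(** The scalar factor of k_j^+ is a series in h/z, so that modulo h^2 only its
    coefficients at z^0 and z^-1 matter. *)
Lemma kplus_comp_mod j k m p : p != 0 -> p != -1 ->
  let s n := pow_shift2 0 4^-1 (ev K i n)
    (if j == ord0 then 5 / 4 else - (3 / 4)) (- ev K i n) in
  hdvd 2 (fexp (Bplus j) (fock_diag s (bvec k) p) (m - p)).
Proof.
move=> p0 p1 s; have rB : hraise 1 (Bplus j) by apply: hraise_expo; exact: fplus.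
have pA : hraise 0 (fexp (Bplus j)) by apply: hraise_fexp; exact: hraiseW rB.
rewrite fock_diag_bvec /s; have [lt|le] := ltP 0 p.
  by rewrite pow_shift2_gt // scale0r (hraise_at0 hF _ pA); exact: hdvd0.
by apply: pA; apply: hdvdW (hdvd_pow_shift2 _ _ _ _ _ _ (hdvd0n _)); lia.
Qed.

Lemma kplus_mod j r k :
  hdvd 2 (kplus i j (bvec k) (- r.+2%:Z) - hvar *: fock_a j r.+1%:Z (bvec k)).
Proof.
have rB : hraise 1 (Bplus j) by apply: hraise_expo; exact: fplus.
have pA : hraise 0 (fexp (Bplus j)) by apply: hraise_fexp; exact: hraiseW rB.
have Bm := expo_mod hF (fun r => fock_a j r.+1%:Z) halfD ppinj cp r (bvec k).
apply: hdvd_trans _ Bm; rewrite kplusE (_ : pp r - 1 = - r.+2%:Z); last by rewrite /pp; lia.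
have ne01 : (0 : int) != -1 by [].
have := hsum2 (n := 2) hF ne01
  (fcomp_diag_summable 4^-1 (if j == ord0 then 5 / 4 else - (3 / 4)) (fun=> 0)
    (ev K i) (fun n => - ev K i n) k (- r.+2%:Z) pA).
move=> h; apply: hdvd_trans (h _) _ => [p p0 p1|]; first exact: kplus_comp_mod.
rewrite !fock_diag_bvec pow_shift2_diag scale1r subr0.
set y := pow_shift2 _ _ _ _ _ _ *: _.
have hy : hdvd 1 y by apply: hdvdW (hdvd_pow_shift2 _ _ _ _ _ _ (hdvd0n _)).
have f0 (v u : Fock K) m : m < 0 -> fone v m + u = u.
  by rewrite foneE; case: eqP => [->|_ _]; rewrite ?ltxx ?add0r.
clearbody y; have h0 := fexp_mod hF (- r.+2%:Z) rB (hdvd0n (bvec k)).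
rewrite (f0 (bvec k) (Bplus j (bvec k) (- r.+2%:Z))) in h0; last by lia.
have h1 := fexp_mod hF (- r.+2%:Z - -1) rB hy.
rewrite (f0 y (Bplus j y (- r.+2%:Z - -1))) in h1; last by lia.
have hB : hdvd 2 (Bplus j y (- r.+2%:Z - -1)) by exact: (rB 1%N).
rewrite addrAC; apply: hdvdD h0 _; apply: hdvd_subr hB _; exact: hdvdW h1.
Qed.

Lemma kplus0_mod k :
  hdvd 2 (kplus i ord0 (bvec k) (-1) + hvar *: (hconst (ev K i k.2) *: bvec k)).
Proof.
set j : 'I_2 := ord0.
have rB : hraise 1 (Bplus j) by apply: hraise_expo; exact: fplus.
have pA : hraise 0 (fexp (Bplus j)) by apply: hraise_fexp; exact: hraiseW rB.
have ne01 : (0 : int) != -1 by [].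
have := hsum2 (n := 2) hF ne01
  (fcomp_diag_summable 4^-1 (if j == ord0 then 5 / 4 else - (3 / 4)) (fun=> 0)
    (ev K i) (fun n => - ev K i n) k (-1) pA).
rewrite kplusE -[hvar *: (hconst (ev K i k.2) *: bvec k)]opprK.
move=> h; apply: hdvd_trans (h _) _ => [p p0 p1|]; first exact: kplus_comp_mod.
rewrite !fock_diag_bvec pow_shift2_diag scale1r subr0 subrr pow_shift2_pred opprK.
set c := hconst _ * _.
have hy : hdvd 1 (c *: bvec k) by rewrite /c mulrC -scalerA; exact: hdvdhZ (hdvd0n _).
have h0 := fexp_mod hF (-1) rB (hdvd0n (bvec k)).
have h1 := fexp_mod hF 0 rB hy.
rewrite foneE add0r in h0; rewrite foneE eqxx in h1.
have hB : hdvd 2 (Bplus j (bvec k) (-1)).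
  by apply: expo_mod0 => // r; rewrite /pp; lia.
have hB' : hdvd 2 (Bplus j (c *: bvec k) 0) by exact: (rB 1%N).
have -> : hvar *: (hconst (ev K i k.2) *: bvec k) = - (c *: bvec k).
  rewrite scalerA /c mulrC -scaleNr -mulNr -hconstN; congr ((hconst _ * _) *: _).
  by have h4 := char0 3; field.
apply: hdvdDB; first exact: hdvd_subr hB h0.
by apply: hdvd_dropr hB' _; exact: hdvdW h1.
Qed.

(** k_1^- is built from a_2, and k_2^- from a_1. *)
Definition other j : 'I_2 := if j == ord0 then ord_max else ord0.

Lemma kminus_mod j r k :
  hdvd 2 (kminus j (bvec k) r%:Z -
    ((if r == 0%N then bvec k else 0) + hvar *: fock_a (other j) (- r.+1%:Z) (bvec k))).
Proof.
have main (a b : K) l : a - b = 1 ->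
    hdvd 2 (fexp (expo a b pm (fun r => (r.+1)%:R^-1) (fun r => fock_a l (- r.+1%:Z))) (bvec k) r%:Z -
    ((if r == 0%N then bvec k else 0) + hvar *: fock_a l (- r.+1%:Z) (bvec k))).
  move=> ab; set C := expo _ _ _ _ _.
  have rC : hraise 1 C by apply: hraise_expo; exact: fminus.
  apply: hdvd_trans (fexp_mod hF r%:Z rC (hdvd0n (bvec k))) _.
  rewrite foneE eqz_nat; apply: hdvd_eqD; first by rewrite subrr; exact: hdvd0.
  have := expo_mod hF (fun r => fock_a l (- r.+1%:Z)) ab pminj cm r (bvec k).
  by rewrite (_ : pm r - 1 = r%:Z) //; rewrite /pm; lia.
rewrite /kminus /other; case: eqP => _; apply: main; first by rewrite subr0.
by rewrite sub0r opprK.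
Qed.
End FockSpace.

Section VertexOperators.
Variable K : fieldType.
Variable i : 'I_2.
Implicit Types (w : Fock K) (j : 'I_2) (m n : int) (A : zfield (Fock K)).

Let hF : hcomplete (Fock K) := hps_hcomplete (fock0 K).

(** ** The vertex operators on the vacuum vectors *)

Definition fpreserves (f : Fock K -> Fock K) := forall d w, hdvd d w -> hdvd d (f w).

Lemma hraise_fock_ser c s f : fpreserves f -> hraise 0 (fock_ser c s f).
Proof. by move=> hf d w m hw; apply: hdvdZ; exact: hf. Qed.

Lemma gainP A : supp_in (cone true) A -> hraise 0 A ->
  (forall d w, hdvd d w -> hdvd d.+1 (A w 0)) -> gain 1 A.
Proof.
move=> sA rA h0; split=> // d w m hw; have [->|ne] := eqVneq m 0; first exact: h0.
by rewrite (_ : (1 - `|m|)%N = 0%N); [exact: rA|lia].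
Qed.

Lemma gain_fock_ser c a r f : fpreserves f ->
  gain 1 (fock_ser c (pow_shift a r.+1%:Z) f).
Proof.
move=> hf; apply: gainP => [w m hm||d w hw]; first by
  rewrite /fock_ser pow_shift_nonneg ?mulr0 ?scale0r //; move: hm; rewrite /cone; lia.
- exact: hraise_fock_ser.
- rewrite /fock_ser -scalerA; apply: hdvdZ.
  by apply: hdvdW (hdvd_pow_shift a r.+1%:Z 0 (hf _ _ hw)); lia.
Qed.

Lemma gain_fadd A B : gain 1 A -> gain 1 B -> gain 1 (fadd A B).
Proof.
move=> [sA gA] [sB gB]; split; first exact: supp_fadd.
by move=> d w m hw; apply: hdvdD; [exact: gA|exact: gB].
Qed.

Lemma gain_fsum (F : nat -> zfield (Fock K)) : (forall r, gain 1 (F r)) -> gain 1 (fsum F).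
Proof.
move=> gF; split; first by apply: (supp_fsum hF) => r; case: (gF r).
by move=> d w m hw; apply: hsum_hdvd => r; case: (gF r) => _; exact.
Qed.

Lemma fock_a_preserves j r : fpreserves (fock_a j r).
Proof. by move=> d w; exact: hraise_fock_a. Qed.

Definition expEminus : zfield (Fock K) := fsum (fun r' : nat => fadd
  (fock_ser (- (r'.+1)%:R^-1) (pow_shift (- (3 / 4)) r'.+1) (fock_a ord0 (- r'.+1%:Z)))
  (fock_ser (r'.+1)%:R^-1 (pow_shift 4^-1 r'.+1) (fock_a ord_max (- r'.+1%:Z)))).

Lemma gain_expEminus : gain 1 expEminus.
Proof.
by apply: gain_fsum => r; apply: gain_fadd; apply: gain_fock_ser; exact: fock_a_preserves.
Qed.

Lemma hraise_Eminus : hraise 0 (@Eminus K).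
Proof. by apply: hraise_fexp; exact: gain_hraise gain_expEminus. Qed.

Lemma supp_Eminus : supp_in (cone true) (@Eminus K).
Proof.
apply: (supp_fexp hF); [exact: (cone0 true)|exact: (@coneD true)| |].
  exact: gain_hraise gain_expEminus.
by case: gain_expEminus.
Qed.

Lemma Eminus0_mod d w : hdvd d w -> hdvd d.+1 (@Eminus K w 0 - w).
Proof. exact: (fexp_taylor0 hF gain_expEminus). Qed.

Let D : zfield (Fock K) := fconst (fun w => @Eminus K w 0).

Let D0 : hraise 0 D.
Proof. by apply: hraise_fconst => d w hw; exact: hraise_Eminus. Qed.

Let D1 : hraise 1 (fsub fone D).
Proof.
move=> d w m hw; rewrite /fsub /fone /D /fconst; case: eqP => _.
  by apply: hdvd_sym; exact: Eminus0_mod.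
by rewrite subr0; exact: hdvd0.
Qed.

Lemma hraise_calE : hraise 0 (@calEminus K).
Proof. exact: (hraise_fcomp (hraise_finv D0) hraise_Eminus). Qed.

Lemma supp_calE : supp_in (cone true) (@calEminus K).
Proof.
apply: (supp_fcomp hF (@coneD true)); [exact: hraise_finv| |exact: supp_Eminus].
apply: (supp_finv hF (cone0 true) (@coneD true)); first exact: D0.
by apply: supp_fconst; exact: (cone0 true).
Qed.

(** The normalization of calE^- makes its constant term 1; modulo h this already
    holds for E^-. *)
Lemma calE0_mod d w : hdvd d w -> hdvd d.+1 (@calEminus K w 0 - w).
Proof.
move=> hw; apply: hdvd_trans (Eminus0_mod hw).
have -> : @calEminus K w 0 = finv D (@Eminus K w 0) 0.
  have sD : supp_in (pred1 0) (finv D).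
    apply: (supp_finv hF) => //; first by move=> a b /eqP -> /eqP ->.
    exact: supp_fconst.
  rewrite /calEminus /fcomp (hsum_single hF (i0 := 0)) ?subr0 // => k k0.
  by apply: sD; rewrite /= sub0r oppr_eq0.
have := finv_mod hF 0 D1 (hraise_Eminus 0 hw).
by rewrite foneE eqxx.
Qed.

Lemma gain_fshift_calE (a : K) : gain 1 (fsub fone (fshift a (@calEminus K))).
Proof.
have rE := hraise_fshift (a) hraise_calE.
apply: gainP.
- by apply: supp_fsub; [apply: supp_fone|apply: (supp_fshift hF); exact: supp_calE].
- by apply: hraise_fsub; [exact: hraise_fone|].
- move=> d w hw; rewrite /fsub foneE eqxx; apply: hdvd_sym.
  by apply: hdvd_trans (fshift_mod1 hF _ _ hraise_calE hw) _; exact: calE0_mod.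
Qed.

Definition vac n : Fock K := bvec K (onecm _, n).

Lemma fock_a_vac j r n : fock_a j r.+1%:Z (vac n) = 0.
Proof.
by rewrite /vac fock_a_bvec_pos /lower onecmE muln0 monalgU0 hconst0.
Qed.

Lemma fock_e_vac n n' : fock_e n (vac n') = vac (n' + n) :> Fock K.
Proof. exact: fock_ext_bvec. Qed.

Definition expEplus : zfield (Fock K) := fsum (fun r' : nat => fadd
  (fock_ser (r'.+1)%:R^-1 (pow_shift 4^-1 (- r'.+1%:Z)) (fock_a ord0 r'.+1))
  (fock_ser (- (r'.+1)%:R^-1) (pow_shift 4^-1 (- r'.+1%:Z)) (fock_a ord_max r'.+1))).

Let expEplus0 : hraise 0 expEplus.
Proof.
by apply: hraise_fsum => r; apply: hraise_fadd; apply: hraise_fock_ser; exact: fock_a_preserves.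
Qed.

Lemma hraise_Eplus : hraise 0 (@Eplus K).
Proof. exact: (hraise_fexp expEplus0). Qed.

Lemma Eplus_vac n m : @Eplus K (vac n) m = fone (vac n) m.
Proof.
apply: (fexp_kill hF m expEplus0) => m'; apply: (hsum_eq0 hF) => r.
by rewrite /fadd /fock_ser !fock_a_vac !scaler0 addr0.
Qed.

(** Only the coefficient of z^0 of a series that fixes v contributes. *)
Lemma fcomp_fix A (B : zfield (Fock K)) w m : hraise 0 A ->
  (forall m, B w m = fone w m) -> (A ** B) w m = A w m.
Proof.
move=> rA hB; rewrite /fcomp (hsum_single hF (i0 := 0)) => [|k /negPf k0].
  by rewrite hB subr0 foneE eqxx.
by rewrite hB foneE k0 (hraise_at0 hF _ rA).
Qed.

(* The exponent (alpha, lambda_i + n alpha). *)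
Let top n : int := n *+ 2 + i%:Z.

(** On a vacuum vector E^+ is trivial, and the lowest power of z modulo h, with
    exponent [top n], comes from the constant term of calE^-. *)
Lemma Xalpha_vac n : hdvd 1 (Xalpha i (vac n) (top n) - vac (n + 1)).
Proof.
have rA := hraise_fcomp hraise_calE hraise_Eplus.
have r1 : hraise 0 (fconst (fock_e 1) : zfield (Fock K)).
  by apply: hraise_fconst => d w; exact: hdvd_fock_ext.
have := fcomp_diag_mod 0 1 top (ev K i) (ev K i) (onecm _, n) (hraise_fcomp rA r1).
move/hdvd_trans; apply.
rewrite (fcomp_fconst_r hF _ _ _ rA) -/(vac n) fock_e_vac.
rewrite fcomp_fix; [|exact: hraise_calE|exact: Eplus_vac].
exact: calE0_mod (hdvd0n _).
Qed.

Lemma Xmalpha_vac n : hdvd 1 (Xmalpha i (vac n) (- top n) - vac (n - 1)).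
Proof.
have r1 := hraise_finv (hraise_fshift (2^-1) hraise_calE).
have rE := hraise_fshift (- 2^-1) hraise_Eplus.
have rA := hraise_fcomp r1 (hraise_finv rE).
have r2 : hraise 0 (fconst (fock_e (-1)) : zfield (Fock K)).
  by apply: hraise_fconst => d w; exact: hdvd_fock_ext.
have := fcomp_diag_mod (- 2^-1) 2^-1 (fun n => - top n) (fun n => - ev K i n)
  (fun n => - ev K i n) (onecm _, n) (hraise_fcomp rA r2).
move/hdvd_trans; apply.
rewrite (fcomp_fconst_r hF _ _ _ rA) -/(vac n) fock_e_vac.
rewrite fcomp_fix; [|exact: r1|move=> m].
  exact: (finv_taylor0 hF (gain_fshift_calE _) (hdvd0n _)).
apply: (finv_kill hF _ rE) => m'; apply: (fshift_fone hF); exact: Eplus_vac.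
Qed.
End VertexOperators.

(** * The classical limit of the action *)

Section ClassicalLimit.
Variable K : fieldType.
Hypothesis char0 : forall n : nat, n.+1%:R != 0 :> K.
Variable i : 'I_2.
Variable rho : amodule (dy_rel K) (Fock K).
Hypothesis hrho : fock_action i rho.
Implicit Types (k : fock_key) (x y : fock0 K) (w : Fock K) (j l : 'I_2).

Let hF : hcomplete (Fock K) := hps_hcomplete (fock0 K).

(** The reduction modulo h of the action of t_jl^(r). *)
Definition tbar j l (r : int) x : fock0 K := rho (dyt K j l r) (hconst x) 0%N.

Lemma fock_hdvd1 w w' : hdvd 1 (w - w') <-> w 0%N = w' 0%N.
Proof.
split=> [/hdvdP/(_ 0%N isT) e|e]; first by apply: subr0_eq; exact: e.
apply/hdvdP => -[|] // _; change (w 0%N - w' 0%N = 0); by rewrite e subrr.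
Qed.

Lemma tbarE j l r w : rho (dyt K j l r) w 0%N = tbar j l r (w 0%N).
Proof.
apply/fock_hdvd1; have : hdvd 1 (w - hconst (w 0%N)) by exact/fock_hdvd1.
move=> /(actr_hdvd rho (dyt K j l r)).
by rewrite actr_D actr_N.
Qed.

Lemma tbar_linear j l r c x y :
  tbar j l r (c *: x + y) = c *: tbar j l r x + tbar j l r y.
Proof.
rewrite /tbar hconstD -hconstZ actr_D actr_Z.
by rewrite hpsDE hconstZE.
Qed.

Lemma tbar_key j l r k x :
  hdvd 1 (rho (dyt K j l r) (bvec K k) - hconst x) -> tbar j l r << k >> = x.
Proof. by move=> /fock_hdvd1. Qed.

Lemma tpart_in (s : pred int) j l w (m r : int) : s m -> - m - 1 = r ->
  tpart rho s j l w m = rho (dyt K j l r) w.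
Proof. by rewrite /tpart => -> ->. Qed.

Lemma tbar_lower j r k : tbar j j r.+1%:Z << k >> = - lower K j r k.
Proof.
apply: tbar_key; rewrite hconstN opprK -fock_a_bvec_pos addrC; apply: (hdvdhZI hF).
have h1 := kseries_mod rho false j (bvec K k) (- r.+2%:Z).
have h2 := kplus_mod char0 i j r k.
rewrite /= (fock_kplus hrho) in h1; have := hdvd_trans (hdvd_sym h2) h1.
rewrite TplusE /mone eqxx foneE (_ : (- r.+2%:Z == 0) = false) // sub0r opprK.
by rewrite (@tpart_in _ _ _ _ _ r.+1%:Z) ?scalerDr //; lia.
Qed.

Lemma tbar_weight k : tbar ord0 ord0 0 << k >> = ev K i k.2 *: << k >>.
Proof.
apply: tbar_key; rewrite -hconstZ; apply: (hdvdhZI hF).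
have h1 := kseries_mod rho false ord0 (bvec K k) (-1).
have h2 := kplus0_mod char0 i k.
rewrite /= (fock_kplus hrho) in h1.
set X := hvar *: (hconst _ *: _) in h2.
have h2' : hdvd 2 (kplus i ord0 (bvec K k) (-1) - - X) by rewrite opprK.
have := hdvd_trans (hdvd_sym h2') h1.
by rewrite TplusE /mone eqxx foneE /= sub0r opprK addrC -scalerBr.
Qed.

Lemma tbar_raise j r k : tbar j j (- r.+1%:Z) << k >> = raise K (other j) r k.
Proof.
apply: tbar_key; rewrite -fock_a_bvec_neg; apply: (hdvdhZI hF).
have h1 := kseries_mod rho true j (bvec K k) r%:Z.
have h2 := kminus_mod char0 j r k.
rewrite /= (fock_kminus hrho) in h1; have := hdvd_trans (hdvd_sym h1) h2.
rewrite TminusE /mone eqxx foneE eqz_nat opprD addrACA subrr add0r -scalerBr.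
rewrite (@tpart_in _ _ _ _ _ (- r.+1%:Z)); [exact: id | by [] | by lia].
Qed.

Lemma tbar_up n : tbar ord0 ord_max (- (n *+ 2 + i%:Z) - 1) << (onecm _, n) >> =
  - << (onecm _, n + 1) >>.
Proof.
apply: tbar_key; rewrite hconstN opprK.
have := Xplus_mod hF rho (vac K n) (n *+ 2 + i%:Z).
rewrite (fock_Xplus hrho) -scalerDr => /(hdvdhZI hF) h.
exact: (hdvd_cancel h (Xalpha_vac K i n)).
Qed.

Lemma tbar_down n : tbar ord_max ord0 (n *+ 2 + i%:Z - 1) << (onecm _, n) >> =
  - << (onecm _, n - 1) >>.
Proof.
apply: tbar_key; rewrite hconstN opprK.
have := Xminus_mod hF rho (vac K n) (- (n *+ 2 + i%:Z)).
rewrite (fock_Xminus hrho) -scalerDr => /(hdvdhZI hF) h.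
by have := hdvd_cancel h (Xmalpha_vac K i n); rewrite opprK.
Qed.

(** ** Irreducibility of the classical limit *)

Section Invariant.
Variable P : fock0 K -> Prop.
Hypotheses (Plin : forall c x y, P x -> P y -> P (c *: x + y))
  (Ptbar : forall j l r x, P x -> P (tbar j l r x)).

Let P_0 x : P x -> P 0.
Proof. by move=> Px; have := Plin (-1) Px Px; rewrite scaleN1r addNr. Qed.

Let PZ c x : P x -> P (c *: x).
Proof. by move=> Px; have := Plin c Px (P_0 Px); rewrite addr0. Qed.

Let PN x : P x -> P (- x).
Proof. by move=> Px; rewrite -scaleN1r; exact: PZ. Qed.

Let PU c k : c != 0 -> P << c *g k >> -> P << k >>.
Proof.
move=> c0 /(PZ c^-1); suff -> : c^-1 *: << c *g k >> = << k >> :> fock0 K by [].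
by apply/malgP => k'; rewrite mcoeffZ !mcoeffU; case: eqP; rewrite ?mulr1n ?mulVf ?mulr0n ?mulr0.
Qed.

Lemma key_split (v : 'I_2 * nat) (m : {cmonom ('I_2 * nat)%type}) : v \in finsupp m ->
  mulcm (ucm v) (divcm m (ucm v)) = m.
Proof.
rewrite -cmE_neq0 => hv; apply/eqP/cmP => u; rewrite mulcmE divcmE ucmE.
by case: eqP => [<-|_]; lia.
Qed.

Lemma mdeg_split (v : 'I_2 * nat) (m : {cmonom ('I_2 * nat)%type}) : v \in finsupp m ->
  mdeg m = (mdeg (divcm m (ucm v))).+1.
Proof. by move=> hv; rewrite -{1}(key_split hv) mdegM mdegU. Qed.

Lemma otherK j : other (other j) = j.
Proof. by case: (ord2_cases j) => ->. Qed.

(** a_j(-r) a_j(r), and the weight: between them they separate the monomial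
    basis. *)
Definition number j (r : nat) x : fock0 K :=
  tbar (other j) (other j) (- r.+1%:Z) (tbar j j r.+1%:Z x).

Lemma number_linear j r c x y : number j r (c *: x + y) = c *: number j r x + number j r y.
Proof. by rewrite /number !tbar_linear. Qed.

Lemma tbar_0 j l r : tbar j l r 0 = 0.
Proof. by have := tbar_linear j l r (-1) 0 0; rewrite scaler0 addr0 scaleN1r addNr. Qed.

Lemma tbarZ j l r c x : tbar j l r (c *: x) = c *: tbar j l r x.
Proof. by have := tbar_linear j l r c x 0; rewrite !addr0 tbar_0 addr0. Qed.

Lemma malgUZ c k : << c *g k >> = c *: << k >> :> fock0 K.
Proof. by apply/malgP => k'; rewrite mcoeffZ !mcoeffU mulrnAr mulr1. Qed.

Lemma scale_eq (V : lmodType K) (c : K) (u v : V) : (c != 0 -> u = v) -> c *: u = c *: v.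
Proof. by case: (eqVneq c 0) => [->|c0 ->] //; rewrite !scale0r. Qed.

Lemma number_key j r k :
  number j r << k >> = - (r.+1 * k.1 (j, r))%:R *: << k >>.
Proof.
rewrite /number tbar_lower /lower malgUZ -scaleNr tbarZ tbar_raise otherK /raise /=.
apply: scale_eq => c0; rewrite key_split -?surjective_pairing //.
by rewrite -cmE_neq0; apply: contraNneq c0 => ->; rewrite muln0 oppr0.
Qed.

Lemma diagonal_coef (f : fock0 K -> fock0 K) (d : fock_key -> K) x k :
  (forall c x y, f (c *: x + y) = c *: f x + f y) ->
  (forall k, f << k >> = d k *: << k >>) -> (f x)@_k = d k * x@_k.
Proof.
move=> flin fd; have f0 : f 0 = 0 by have := flin (-1) 0 0; rewrite scaler0 addr0 scaleN1r addNr.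
have fsum (r : seq fock_key) (c : fock_key -> K) :
    f (\sum_(k <- r) c k *: << k >>) = \sum_(k <- r) c k *: f << k >>.
  by elim: r => [|k' r IH]; rewrite ?big_nil // !big_cons flin IH.
have xE : x = \sum_(k <- msupp x) x@_k *: << k >>.
  by rewrite {1}[x]monalgE; apply: eq_bigr => k' _; rewrite -malgUZ.
rewrite xE fsum !raddf_sum /= mulr_sumr; apply: eq_bigr => k' _.
rewrite fd !mcoeffZ mcoeffU; case: eqP => [->|_]; first by rewrite mulr1n !mulr1 mulrC.
by rewrite mulr0n !mulr0.
Qed.

Lemma separate k k' : k != k' -> exists f d,
  [/\ forall x, P x -> P (f x), forall c x y, f (c *: x + y) = c *: f x + f y,
      forall k, f << k >> = d k *: << k >> & d k != d k'].
Proof.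
have natK_le (a b : nat) : (a <= b)%N -> a%:R = b%:R :> K -> a = b.
  move=> le e; have : (b - a)%:R = 0 :> K by rewrite natrB // e subrr.
  case eba: (b - a)%N => [|c] => [_|/eqP]; first by lia.
  by rewrite (negPf (char0 c)).
have natK (a b : nat) : a%:R = b%:R :> K -> a = b.
  by case/orP: (leq_total a b) => h e; [|symmetry]; exact: natK_le.
case: k k' => m n [m' n']; rewrite xpair_eqE negb_and => /orP[mm|nn].
  have [v hv] : exists v, m v != m' v.
    apply: contrapT => h; case/negP: mm; apply/cmP => v; apply/eqP.
    by case: eqP => // /eqP hv; case: h; exists v.
  case: v hv => j r hv; exists (number j r), (fun k => - (r.+1 * k.1 (j, r))%:R); split.
  - by move=> x Px; do 2!apply: Ptbar.
  - exact: number_linear.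
  - exact: number_key.
  - by rewrite /= eqr_opp; apply: contraNneq hv => /natK/eqP; rewrite eqn_mul2l.
exists (tbar ord0 ord0 0), (fun k => ev K i k.2); split.
- exact: Ptbar.
- exact: tbar_linear.
- exact: tbar_weight.
- rewrite /= /ev (inj_eq (addIr _)); apply: contraNneq nn => e.
  have {}e : (n - n')%:~R = 0 :> K by rewrite rmorphB /= e subrr.
  rewrite -subr_eq0; case: (n - n') e => -[|c] //.
  - by move=> /eqP; rewrite (negPf (char0 c)).
  - by rewrite NegzE mulrNz => /eqP; rewrite oppr_eq0 (negPf (char0 0)).
  - by rewrite NegzE mulrNz => /eqP; rewrite oppr_eq0 (negPf (char0 c.+1)).
Qed.

(** In a nonzero vector with the fewest monomials there is only one monomial,
    since a diagonal operator which separates two of them yields a shorter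
    nonzero vector. *)
Lemma key_in x : P x -> x != 0 -> exists k, P << k >>.
Proof.
have [n] := ubnP #|` msupp x|; elim: n x => // n IH x lt Px x0.
have [k kx] : exists k, k \in msupp x.
  apply: contrapT => h; case/eqP: x0; apply/malgP => k; rewrite mcoeff0.
  by apply: mcoeff_outdom; apply/negP => kx; apply: h; exists k.
have [ [k' /andP[kk' k'x]]|h] := pselect (exists k', (k != k') && (k' \in msupp x)); last first.
  exists k; apply: (@PU x@_k); first by rewrite mcoeff_neq0.
  suff <- : x = << x@_k *g k >> by [].
  apply/malgP => k'; rewrite mcoeffU; case: eqP => [<-|ne] //=.
  rewrite mulr0n mcoeff_outdom //; apply/negP => k'x; apply: h.
  by exists k'; rewrite k'x andbT; apply/eqP.
have [f [d [Pf flin fd dd]]] := separate kk'.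
pose y := - d k *: x + f x.
have yE p : y@_p = (d p - d k) * x@_p.
  by rewrite mcoeffD mcoeffZ (diagonal_coef _ _ flin fd) mulrBl addrC mulNr.
apply: (IH y); last 2 first.
- by apply: Plin => //; exact: Pf.
- apply/eqP => /(congr1 (mcoeff k')); rewrite yE mcoeff0 => /eqP.
  by rewrite mulf_eq0 subr_eq0 eq_sym (negPf dd) mcoeff_eq0 k'x.
rewrite -ltnS; apply: leq_trans lt; rewrite ltnS; apply: fproper_ltn_card; rewrite fproperE.
apply/andP; split; first apply/fsubsetP => p.
  by rewrite -!mcoeff_neq0 yE; apply: contraNN => /eqP ->; rewrite mulr0.
apply/negP => /fsubsetP/(_ k kx); rewrite -mcoeff_neq0 yE subrr mul0r.
by rewrite eqxx.
Qed.

Lemma key_lower m n : P << (m, n) >> -> P << (onecm _, n) >>.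
Proof.
have [d] := ubnP (mdeg m); elim: d m => [m|d IH m lt Pm]; first by rewrite ltn0 => H; discriminate H.
have [/fset0Pn|] := boolP (finsupp m != fset0)%fset; last first.
  rewrite negbK => /eqP m0; suff <- : m = onecm _ by [].
  by apply/eqP/cmP => v; rewrite onecmE; apply/eqP; rewrite cmE_eq0 m0.
move=> [[j r] hv]; apply: (IH (divcm m (ucm (j, r)))).
  by move: lt; rewrite (mdeg_split hv).
have := Ptbar j j r.+1%:Z Pm; rewrite tbar_lower => /PN; rewrite opprK; apply: PU.
rewrite -cmE_neq0 in hv; case e: (_ * _)%N => [|c]; last exact: char0.
by move/eqP: e; rewrite muln_eq0 /= (negPf hv).
Qed.

Lemma key_raise m n : P << (onecm _, n) >> -> P << (m, n) >>.
Proof.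
have [d] := ubnP (mdeg m); elim: d m => [m|d IH m lt P1]; first by rewrite ltn0 => H; discriminate H.
have [/fset0Pn|] := boolP (finsupp m != fset0)%fset; last first.
  rewrite negbK => /eqP m0; suff -> : m = onecm _ by [].
  by apply/eqP/cmP => v; rewrite onecmE; apply/eqP; rewrite cmE_eq0 m0.
move=> [[j r] hv]; have lt' : (mdeg (divcm m (ucm (j, r))) < d)%N.
  by move: lt; rewrite (mdeg_split hv).
have := Ptbar (other j) (other j) (- r.+1%:Z) (IH _ lt' P1).
rewrite tbar_raise otherK.
have -> : raise K j r (divcm m (ucm (j, r)), n) = << (m, n) >>.
  by rewrite -{2}(key_split hv).
exact.
Qed.

Lemma invariant_full x y : P x -> x != 0 -> P y.
Proof.
move=> Px x0; have [ [m0 n0] /key_lower Pk] := key_in Px x0.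
have up n : P << (onecm _, n) >> -> P << (onecm _, n + 1) >>.
  by move=> /(Ptbar ord0 ord_max (- (n *+ 2 + i%:Z) - 1)); rewrite tbar_up => /PN; rewrite opprK.
have down n : P << (onecm _, n) >> -> P << (onecm _, n - 1) >>.
  by move=> /(Ptbar ord_max ord0 (n *+ 2 + i%:Z - 1)); rewrite tbar_down => /PN; rewrite opprK.
have Pall n : P << (onecm _, n) >>.
  rewrite -(subrK n0 n) addrC; elim/int_rec: (n - n0) => [|d IH|d IH].
  - by rewrite addr0.
  - by rewrite (_ : n0 + d.+1%:Z = n0 + d%:Z + 1); [exact: up|lia].
  - by rewrite (_ : n0 - d.+1%:Z = n0 - d%:Z - 1); [exact: down|lia].
have Psum (c : fock_key -> K) (r : seq fock_key) : P (\sum_(p <- r) c p *: << p >>).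
  elim: r => [|p r IH].
    rewrite big_nil.
    exact: (P_0 Px).
  rewrite big_cons.
  apply: Plin IH.
  case: p => m n.
  exact: key_raise (Pall n).
rewrite [y]monalgE (eq_bigr (fun p => y@_p *: << p >>)) => [|p _].
  exact: Psum.
exact: malgUZ.
Qed.
End Invariant.

(** The values at h = 0 of the elements of Q form an invariant subspace of the
    classical limit. *)
Lemma full_mod_h (Q : Fock K -> Prop) :
  (forall c w w', Q w -> Q w' -> Q (c *: w + w')) ->
  (forall j l r w, Q w -> exists2 w', Q w' & hdvd 1 (w' - rho (dyt K j l r) w)) ->
  (exists2 w, Q w & w 0%N != 0) ->
  forall x : Fock K, exists2 w, Q w & hdvd 1 (x - w).
Proof.
move=> Qlin Qt [w Qw w0] x.
pose P y := exists2 w, Q w & w 0%N = y.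
have Plin c y z : P y -> P z -> P (c *: y + z).
  move=> [u Qu <-] [v Qv <-]; exists (hconst c *: u + v); first exact: Qlin.
  by rewrite hpsDE hconstZE.
have Ptbar j l r y : P y -> P (tbar j l r y).
  move=> [u Qu <-]; have [v Qv /fock_hdvd1 e] := Qt j l r u Qu.
  by exists v => //; rewrite e tbarE.
have [u Qu e] : P (x 0%N) by apply: (invariant_full Plin Ptbar _ _ w0); exists w.
by exists u => //; apply/fock_hdvd1.
Qed.
End ClassicalLimit.

(** * The modules L_i *)

Section LModule.
Variable K : fieldType.
Hypothesis char0 : forall n : nat, n.+1%:R != 0 :> K.
Variable i : 'I_2.
Variable rho : amodule (dy_rel K) (Fock K).
Hypothesis hrho : fock_action i rho.
Implicit Types (w : L rho) (j l : 'I_2).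

Let hF : hcomplete (Fock K) := hps_hcomplete (fock0 K).
Let v0 : Fock K := fock_vac K.

(** The orbit of the vacuum is everything modulo h, and it is the image of a
    complete module. *)
Lemma orbit_full (x : Fock K) : x \in orbit_pred rho v0.
Proof.
pose f (a : hps (free_alg K (dy_gen))) : Fock K := rho (pproj (dy_rel K) a) v0.
have [|c a b|y|a <-] := @surj_mod_h _ (free_alg K (dy_gen)) _ f _ _ _ x.
- exact: hc_sep hF.
- by rewrite /f pactD pactZ.
- pose Q y := exists a, y = rho a v0.
  have [c y1 y2 [a ->] [b ->]|j l r y1 [a ->]||z [a ->] hz] :=
      @full_mod_h K char0 i rho hrho Q _ _ _ y.
  + by exists (c *: a + b); rewrite act_linearl.
  + exists (rho (dyt K j l r) (rho a v0)); last by rewrite subrr; exact: hdvd0.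
    by exists (dyt K j l r * a); rewrite actM.
  + exists v0; first by exists 1; rewrite act1.
    apply/eqP => /(congr1 (mcoeff (onecm _, 0))) /eqP.
    by rewrite mcoeff0 mcoeffUU oner_eq0.
  + by exists (repr a); rewrite /f /pproj reprK.
- by apply/asboolP; exists (pproj (dy_rel K) a).
Qed.

Definition to_L (x : hps (fock0 K)) : L rho := Cyclic (orbit_full x).

Lemma to_L_linear : linear to_L.
Proof. by move=> c x y; apply: val_inj. Qed.
HB.instance Definition _ :=
  GRing.isLinear.Build (hps K) (hps (fock0 K)) (L rho) _ to_L to_L_linear.

Lemma L_topfree : topfree [set: L rho]%classic.
Proof.
exists (fock0 K), to_L; split; first by move=> x y /(congr1 val).
apply/seteqP; split=> // w _; exists (val w) => //; exact: val_inj.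
Qed.

Let hL : hcomplete (L rho) := topfree_hcomplete L_topfree.
Let rL : amodule (dy_rel K) (L rho) := L_amodule rho.

Lemma val_hdvd n w : hdvd n (val w : Fock K) -> hdvd n w.
Proof. by move=> [y e]; exists (to_L y); apply: val_inj; exact: e. Qed.

Lemma hdvd_val n w : hdvd n w -> hdvd n (val w : Fock K).
Proof. by move=> [y ->]; exists (val y). Qed.

(** A saturated topologically free submodule of L_i is determined by its
    reduction, so it suffices that it be stable modulo h. *)
Lemma irreducible_mod_h (ops : set (L rho -> L rho)) :
  (forall j l r, exists2 op, ops op &
     forall w, hdvd 1 (op w - rL (dyt K j l r) w)) ->
  irreducible_under ops.
Proof.
move=> hops; split; first exact: L_topfree.
move=> W [V [f [finj fW]]] Wops Wsat.
have Wf x : W (f x) by rewrite -fW; exists x.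
have fex w : W w -> exists x, f x = w by rewrite -fW => -[x _ <-]; exists x.
have W0 : W 0 by have := Wf 0; rewrite raddf0.
have [zero|[w [Ww w0]]] : (forall w, W w -> w = 0) \/ exists w, W w /\ w <> 0.
  have [h|h] := pselect (exists w, W w /\ w <> 0); [by right|left=> w Ww].
  by apply: contrapT => w0; apply: h; exists w.
  by left; apply/seteqP; split=> [w /zero|w ->].
right; apply/seteqP; split=> // w1 _.
have [u Wu u0] : exists2 u, W u & ~ hdvd 1 u.
  apply: contrapT => h; apply: w0; apply: (hc_sep hL) => n.
  elim: n => [|n [u e]]; first exact: hdvd0n.
  have Wu : W u.
    case: n e => [|n] e; first by rewrite e expr0 scale1r in Ww.
    by apply: (Wsat n.+1) => //; rewrite -e.
  have [z ez] : hdvd 1 u by apply: contrapT => hu; apply: h; exists u.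
  by exists z; rewrite e ez scalerA -exprD addn1.
suff [x <-] : exists x, f x = w1 by [].
apply: surj_mod_h => [|c x y|y]; first exact: hc_sep hL.
  by rewrite linearP.
pose Q (x : Fock K) := W (to_L x).
have [c x1 x2 Q1 Q2|j l r x1 Q1||x Qx hx] := @full_mod_h K char0 i rho hrho Q _ _ _ (val y).
- rewrite /Q to_L_linear; have [y1 <-] := fex _ Q1; have [y2 <-] := fex _ Q2.
  by rewrite -linearP; exact: Wf.
- have [op hop opE] := hops j l r; exists (val (op (to_L x1))).
    by rewrite /Q (_ : to_L _ = op (to_L x1)); [exact: Wops|exact: val_inj].
  exact: (hdvd_val (opE (to_L x1))).
- exists (val u); first by rewrite /Q (_ : to_L _ = u) //; exact: val_inj.
  apply/eqP => e; apply: u0; apply: val_hdvd; rewrite -[val u]subr0.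
  by apply/fock_hdvd1.
- have [z ez] := fex _ Qx; exists z; rewrite ez; apply: val_hdvd; exact: hx.
Qed.

Lemma L_irreducible : irreducible_amodule rL.
Proof.
apply: irreducible_mod_h => j l r; exists (rL (dyt K j l r)); first by exists (dyt K j l r).
by move=> w; rewrite subrr; exact: hdvd0.
Qed.

Lemma L_level_one : level_one rL.
Proof. by move=> w; apply: val_inj; exact: fock_level_one hrho (val w). Qed.

Lemma L_hlaurent j l : hlaurent (Tplus rL j l).
Proof.
apply: (hlaurent_Tplus hL) => w n.
have [N hN] := hlaurent_kplus i ord0 (val w) n; exists N => m /hN h.
by apply: val_hdvd; move: h; rewrite -(fock_kplus hrho).
Qed.

Section VertexAlgebra.
Variables (YL : V1 K -> zfield (L rho)).
Hypotheses (YLmap : is_vertex_map YL) (YL1 : forall w m, YL 1 w m = fone w m)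
  (YLf : vertex_formula rL YL).

Lemma V1tminusE j l : V1tminus K j l 0 =
  ((j == l)%:R *: (1 : V1 K) : V1 K) + (hvar *: V1t K j l 0 : V1 K).
Proof.
rewrite /V1tminus /y_tminus /= pprojD pprojZ; congr (_ + _).
by case: (j == l); rewrite ?scale1r // scale0r.
Qed.

(** In the vertex operator formula for T^-(0) = 1 + h t^(-1), subtract
    Y(1, z) = 1 and cancel h. *)
Lemma YL_mod j l r w : hdvd 1 (YL (V1t K j l 0) w (- r - 1) - rL (dyt K j l r) w).
Proof.
apply: (hdvdhZI hL); rewrite scalerBr.
have := vertex_rhs_mod hL L_hlaurent j l w (- r - 1).
rewrite -[vertex_rhs _ _ _ _ _](YLf [:: (j, l, 0%N)]) big_seq1 /=.
rewrite V1tminusE (vertex_linearl YLmap) YL1.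
have -> : YL (hvar *: V1t K j l 0) w (- r - 1) = hvar *: YL (V1t K j l 0) w (- r - 1).
  have := vertex_linearl YLmap hvar (V1t K j l 0) 0 w (- r - 1).
  have := vertex_linearl YLmap (-1) 0 0 w (- r - 1).
  by rewrite scaler0 addr0 scaleN1r addNr => ->; rewrite !addr0.
rewrite (_ : - (- r - 1) - 1 = r); last by lia.
rewrite /mone; case: (j == l); rewrite ?scale1r ?scale0r.
  by rewrite opprD addrACA subrr add0r.
by rewrite opprD addrACA subrr add0r.
Qed.

Lemma L_qva_irreducible : irreducible_qva_module YL.
Proof.
apply: irreducible_mod_h => j l r.
exists (fun w => YL (V1t K j l 0) w (- r - 1)); last by move=> w; exact: YL_mod.
by exists (V1t K j l 0), (- r - 1).
Qed.
End VertexAlgebra.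
End LModule.

Theorem corollary4p8 (R : realType) (i : 'I_2)
  (* the DY(gl_2)-module F_i, with submodule L_i = L rho *)
  (rho : amodule (dy_rel (CC R)) (Fock (CC R))) (hrho : fock_action i rho)
  (* V^1(gl_2) as a DY(gl_2)-module, and its vertex operator map *)
  (sigma : amodule (dy_rel (CC R)) (V1 (CC R))) (hsigma : vacuum_action sigma)
  (Y : V1 (CC R) -> zfield (V1 (CC R)))
  (hY : is_vertex_map Y) (hYf : vertex_formula sigma Y)
  (* L_i as a V^1(gl_2)-module *)
  (YL : V1 (CC R) -> zfield (L rho))
  (hYL : qva_module Y 1 YL) (hYLf : vertex_formula (L_amodule rho) YL) :
  irreducible_qva_module YL /\
  (level_one (L_amodule rho) /\ irreducible_amodule (L_amodule rho)).
Proof.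
have char0 (n : nat) : n.+1%:R != 0 :> CC R by rewrite /CC pnatr_eq0.
split; last by split; [exact: L_level_one hrho|exact: (L_irreducible char0 hrho)].
exact: (L_qva_irreducible char0 hrho (qva_vertex_map hYL) (qva_vacuum hYL) hYLf).
Qed.
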